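(* Let $L = p(t)\partial_t + q(t)\partial_x$ be a vector field on $\mathbb{R}^2$ with coordinates $(t,x)$, where $p,q$ are real polynomials with no common zeros. Assume that there are an integer $N\ge 2$ and $t_1<\dots<t_N$ such that $p(t)=0$ if and only if $t\in\{t_1,\dots,t_N\}$, that $p'(t_j)\neq 0$ for $j=1,\dots,N$, and that $q$ has at most one zero in $]t_j,t_{j+1}[$ for each $j=1,\dots,N-1$. Then the following assertions are equivalent: i) $L$ is not surjective in $C^\infty(\mathbb{R}^2)$, i.e. $L: C^\infty(\mathbb{R}^2)\to C^\infty(\mathbb{R}^2)$ is not onto; ii) $L$ admits a separatrix $S_j$ for some $j\in\{1,\dots,N-1\}$; iii) there exist $j\in\{1,\dots,N-1\}$ and $\theta_j\in\,]t_j,t_{j+1}[$ such that $q(\theta_j)=0$ and $q$ has opposite signs in $]t_j,\theta_j[$ and $]\theta_j,t_{j+1}[$. In particular, for $\lambda\in\mathbb{R}\setminus\{0\}$ and $k\in\mathbb{N}$, the operator $L_{\lambda,k} = (1-t^2)\partial_t+\lambda t^k\partial_x$ is not surjective in $C^\infty(\mathbb{R}^2)$ if and only if $k$ is odd.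
   Context: For $j\in\{1,\dots,N-1\}$ let $S_j=\{(t,x): t\in\,]t_j,t_{j+1}[,\ x\in\mathbb{R}\}$. For $(\tau,y)\in S_j$ the characteristic curve $x=x(t;\tau,y)$, $t\in\,]t_j,t_{j+1}[$, is the solution of $\dot x(t)=q(t)/p(t)$, $x(\tau)=y$. The strip $S_j$ is called a separatrix for $L$ if all characteristic curves starting at a point $(\tau,y)\in S_j$ satisfy either $\lim_{t\to t_j^+}x(t;\tau,y)=\lim_{t\to t_{j+1}^-}x(t;\tau,y)=+\infty$, or $\lim_{t\to t_j^+}x(t;\tau,y)=\lim_{t\to t_{j+1}^-}x(t;\tau,y)=-\infty$. *)

(* Defs.v *)
From Stdlib Require Import Reals Arith.
From Coquelicot Require Import Coquelicot.
Open Scope R_scope.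

(* Over R, polynomials are identified with the functions they induce. *)
Definition is_polynomial (p : R -> R) : Prop :=
  exists (a : nat -> R) (d : nat),
    forall t, p t = sum_f_R0 (fun k => a k * t ^ k) d.

(* [ex_diff_n u n t x] asks, for all iterated partial derivatives of [u] (in
   any order) up to total order [n], for existence and joint continuity at
   (t, x). *)
Definition C_infty (u : R -> R -> R) : Prop :=
  forall n t x, ex_diff_n u n t x.

Definition vector_field (p q : R -> R) (u : R -> R -> R) : R -> R -> R :=
  fun t x => p t * Derive (fun s => u s x) t + q t * Derive (fun y => u t y) x.

Definition surjective_C_infty (L : (R -> R -> R) -> (R -> R -> R)) : Prop :=
  forall f, C_infty f ->
    exists u, C_infty u /\ forall t x, L u t x = f t x.

(* [x] is the curve x(.; tau, y) on ]a,b[; its values outside ]a,b[ are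
   irrelevant. *)
Definition characteristic_curve (p q : R -> R) (a b tau y : R) (x : R -> R)
    : Prop :=
  (forall t, a < t < b -> is_derive x t (q t / p t)) /\ x tau = y.

(* The strip is ]a,b[ x R.  When p and q are continuous and p has no zero in
   ]a,b[, there is exactly one characteristic curve on ]a,b[ through each point
   of the strip. *)
Definition separatrix (p q : R -> R) (a b : R) : Prop :=
  forall tau y x, a < tau < b -> characteristic_curve p q a b tau y x ->
    (filterlim x (at_right a) (Rbar_locally p_infty) /\
     filterlim x (at_left b) (Rbar_locally p_infty)) \/
    (filterlim x (at_right a) (Rbar_locally m_infty) /\
     filterlim x (at_left b) (Rbar_locally m_infty)).

Definition opposite_signs (q : R -> R) (a theta b : R) : Prop :=
  ((forall s, a < s < theta -> 0 < q s) /\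
   (forall s, theta < s < b -> q s < 0)) \/
  ((forall s, a < s < theta -> q s < 0) /\
   (forall s, theta < s < b -> 0 < q s)).

(* Main.v *)
Require Import Defs.
From Stdlib Require Import Reals Arith Lra Lia Ranalysis5.
From Stdlib Require Import FunctionalExtensionality Classical.
From Coquelicot Require Import Coquelicot.
Open Scope R_scope.

(** The orbits of L in the strip over ]t_j, t_{j+1}[ are the characteristic curves x' = q/p.
    At the ends p vanishes and q does not, so that |x'| is at least a constant over the distance
    to the end and x diverges logarithmically ([log_divergence]); the sign of the infinity is
    given by those of q and p. As p has one sign in the strip, the two ends of a curve go to
    the same infinity exactly when q has opposite signs at t_j and t_{j+1}
    ([separatrix_iff]), which amounts to a sign change at an inner zero of q
    ([opposite_signs_iff]).

    A separatrix prevents L u = 1 ([not_surjective_of_equal_limits]): two points of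
    the axis x = 0 close to the two ends of the strip can lie on the same orbit, at distance
    tending to infinity in the time of the flow of L; the difference of the values of u there
    is this time, whereas u is bounded on the axis between the ends.

    If there is no separatrix, q has the same sign, say positive, at all zeros of p. A shear
    (t, x) -> (t, x - h(t)) replaces q by q - p h', and h' = - c p with a large positive
    polynomial c gives Q = q + c p^2 > 0 with p/Q bounded ([surjective_of_pos]). Then L = Q
    (r d/dt + d/dx) with r = p/Q: the line x = h(t) meets each orbit exactly once, and f/Q is
    integrated along the orbits from there ([transport_solvable]). This requires the global flow
    of a bounded smooth field on the line and its joint smoothness. The flow comes from
    Picard's iteration ([flow_solution]); its derivative in the initial point t is the exponential
    of the integral of r' along the orbit ([flow_derive_initial]), and this formula raises the
    regularity of the flow by one order at a time ([flow_smooth]). *)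

(** * Functions of class C^n of two variables *)

Lemma is_derive_eq (f : R -> R) (x l l' : R) :
  is_derive f x l -> l = l' -> is_derive f x l'.
Proof. now intros H <-. Qed.

Lemma is_derive_continuity_pt (f : R -> R) (x l : R) :
  is_derive f x l -> continuity_pt f x.
Proof.
  intros H. apply continuity_pt_filterlim.
  apply (ex_derive_continuous (K := R_AbsRing) (V := R_NormedModule)).
  now exists l.
Qed.

Lemma continuity_2d_comp (F A B : R -> R -> R) (x y : R) :
  continuity_2d_pt F (A x y) (B x y) ->
  continuity_2d_pt A x y -> continuity_2d_pt B x y ->
  continuity_2d_pt (fun x y => F (A x y) (B x y)) x y.
Proof.
  rewrite !continuity_2d_pt_filterlim. intros HF HA HB.
  apply (filterlim_comp_2 (F := locally (x, y)) (G := locally (A x y))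
    (H := locally (B x y)) _ _ _ HA HB).
  intros P HP. destruct (HF P HP) as [e He].
  exists (fun u => ball (A x y) e u) (fun u => ball (B x y) e u).
  - now exists e.
  - now exists e.
  - intros u v Hu Hv. apply (He (u, v)). now split.
Qed.

Lemma continuity_2d_slice (k : R -> R -> R) (x y : R) :
  continuity_2d_pt k x y -> continuous (k x) y.
Proof.
  rewrite continuity_2d_pt_filterlim. intros H.
  apply (continuous_comp_2 (fun _ : R => x) (fun z : R => z) k).
  - apply continuous_const.
  - apply continuous_id.
  - exact H.
Qed.

Lemma continuity_2d_fst (c : R -> R) (x y : R) :
  continuity_pt c x -> continuity_2d_pt (fun a _ => c a) x y.
Proof.
  intros H. apply continuity_2d_pt_filterlim.
  apply (continuous_comp (fun z : R * R => fst z) c).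
  - apply continuous_fst.
  - now apply continuity_pt_filterlim.
Qed.

Lemma ex_RInt_R (f : R -> R) (a b : R) :
  (forall s, continuous f s) -> ex_RInt f a b.
Proof.
  intros H. apply (ex_RInt_continuous (V := R_CompleteNormedModule)); auto.
Qed.

(** No order between a and b is assumed, so that the bound serves for the flow in
    both directions of time. *)
Lemma RInt_bound (f : R -> R) (a b M : R) :
  (forall s, continuous f s) ->
  (forall s, Rmin a b <= s <= Rmax a b -> Rabs (f s) <= M) ->
  Rabs (RInt f a b) <= M * Rabs (b - a).
Proof.
  intros Hc HM. destruct (Rle_dec a b) as [Hab | Hab].
  - rewrite Rmin_left, Rmax_right in HM by lra.
    rewrite (Rabs_right (b - a)) by lra. rewrite Rmult_comm.
    apply abs_RInt_le_const; auto. apply ex_RInt_R; auto.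
  - rewrite Rmin_right, Rmax_left in HM by lra.
    rewrite <- (opp_RInt_swap (V := R_CompleteNormedModule)) by (apply ex_RInt_R; auto).
    unfold opp; simpl. rewrite Rabs_Ropp.
    rewrite (Rabs_left (b - a)) by lra.
    replace (M * - (b - a)) with ((a - b) * M) by ring.
    apply abs_RInt_le_const; auto; try lra. apply ex_RInt_R; auto.
Qed.

Lemma is_derive_RInt_R (f : R -> R) (a x : R) :
  (forall s, continuous f s) -> is_derive (fun z => RInt f a z) x (f x).
Proof.
  intros Hc. apply (is_derive_RInt f (fun z => RInt f a z) a x); auto.
  exists (mkposreal 1 Rlt_0_1). intros y _.
  apply (RInt_correct (V := R_CompleteNormedModule)), ex_RInt_R; auto.
Qed.

(** Continuity of one partial derivative already makes F differentiable, which is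
    what a chain rule along a curve requires. *)
Lemma is_derive_comp_2d (F F1 F2 : R -> R -> R) (a b : R -> R) (s a' b' : R) :
  (forall x y, is_derive (fun z => F z y) x (F1 x y)) ->
  is_derive (F (a s)) (b s) (F2 (a s) (b s)) ->
  continuity_2d_pt F1 (a s) (b s) ->
  is_derive a s a' -> is_derive b s b' ->
  is_derive (fun s => F (a s) (b s)) s
    (F1 (a s) (b s) * a' + F2 (a s) (b s) * b').
Proof.
  intros H1 H2 Hc Ha Hb. apply is_derive_Reals.
  apply derivable_pt_lim_comp_2d; try (now apply is_derive_Reals).
  apply filterdiff_differentiable_pt_lim.
  eapply filterdiff_ext_lin.
  - apply (is_derive_filterdiff F (a s) (b s) F1 (F2 (a s) (b s))).
    + now exists (mkposreal 1 Rlt_0_1).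
    + exact H2.
    + now apply continuity_2d_pt_filterlim.
  - reflexivity.
Qed.

Lemma continuity_2d_of_partials (F F1 F2 : R -> R -> R) :
  (forall x y, is_derive (fun z => F z y) x (F1 x y)) ->
  (forall x y, is_derive (F x) y (F2 x y)) ->
  (forall x y, continuity_2d_pt F1 x y) ->
  forall x y, continuity_2d_pt F x y.
Proof.
  intros H1 H2 Hc x y. apply differentiable_continuity_pt.
  exists (F1 x y), (F2 x y). apply filterdiff_differentiable_pt_lim.
  eapply filterdiff_ext_lin.
  - apply (is_derive_filterdiff F x y F1 (F2 x y)).
    + now exists (mkposreal 1 Rlt_0_1).
    + apply H2.
    + now apply continuity_2d_pt_filterlim.
  - reflexivity.
Qed.

(** C^n on the whole plane, with partial derivatives given as witnesses: a proof
    of stability then exhibits the derivatives instead of rewriting [Derive]. *)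
Fixpoint Ck (n : nat) (f : R -> R -> R) : Prop :=
  (forall x y, continuity_2d_pt f x y) /\
  match n with
  | O => True
  | S m => exists f1 f2,
      (forall x y, is_derive (fun z => f z y) x (f1 x y)) /\
      (forall x y, is_derive (f x) y (f2 x y)) /\ Ck m f1 /\ Ck m f2
  end.

Definition smooth (f : R -> R -> R) : Prop := forall n, Ck n f.

Lemma Ck_continuity n f : Ck n f -> forall x y, continuity_2d_pt f x y.
Proof. destruct n; now intros [H _]. Qed.

Lemma Ck_S n f f1 f2 :
  (forall x y, is_derive (fun z => f z y) x (f1 x y)) ->
  (forall x y, is_derive (f x) y (f2 x y)) -> Ck n f1 -> Ck n f2 ->
  Ck (S n) f.
Proof.
  intros H1 H2 C1 C2. split.
  - apply (continuity_2d_of_partials f f1 f2); auto. now apply (Ck_continuity n).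
  - now exists f1, f2.
Qed.

(** The derivatives are unique as functions, so the witnesses of [Ck] are the
    iterated [Derive]s of [ex_diff_n]. *)
Lemma Ck_ex_diff n f : (forall x y, ex_diff_n f n x y) <-> Ck n f.
Proof.
  revert f. induction n as [|n IH]; intros f.
  - split.
    + intros H. split; auto. intros x y. apply (H x y).
    + intros [H _] x y. now split.
  - split.
    + intros H. split. { intros x y. apply (H x y). }
      exists (fun u v => Derive (fun z => f z v) u),
        (fun u v => Derive (fun z => f u z) v).
      split; [|split; [|split]].
      * intros x y. apply Derive_correct. apply (H x y).
      * intros x y. apply Derive_correct. apply (H x y).
      * apply IH. intros x y. apply (H x y).
      * apply IH. intros x y. apply (H x y).
    + intros [Hc [f1 [f2 [H1 [H2 [C1 C2]]]]]] x y.
      assert (E1 : (fun u v => Derive (fun z => f z v) u) = f1).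
      { extensionality u. extensionality v. now apply is_derive_unique. }
      assert (E2 : (fun u v => Derive (fun z => f u z) v) = f2).
      { extensionality u. extensionality v. now apply is_derive_unique. }
      split; [apply Hc|]. rewrite E1, E2. repeat split.
      * now exists (f1 x y).
      * now exists (f2 x y).
      * now apply IH.
      * now apply IH.
Qed.

Lemma smooth_C_infty f : C_infty f <-> smooth f.
Proof.
  split.
  - intros H n. apply Ck_ex_diff. intros x y. apply H.
  - intros H n x y. revert x y. now apply Ck_ex_diff.
Qed.

Lemma Ck_down n f : Ck (S n) f -> Ck n f.
Proof.
  revert f. induction n as [|n IH]; intros f [Hc [f1 [f2 [H1 [H2 [C1 C2]]]]]].
  - now split.
  - apply (Ck_S n f f1 f2); auto.
Qed.

Lemma Ck_const n c : Ck n (fun _ _ => c).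
Proof.
  revert c. induction n as [|n IH]; intros c.
  - split; auto. intros x y. apply continuity_2d_pt_const.
  - apply (Ck_S n _ (fun _ _ => 0) (fun _ _ => 0)); auto;
      intros x y; apply (is_derive_const (K := R_AbsRing) (V := R_NormedModule)).
Qed.

Lemma Ck_fst n : Ck n (fun x _ => x).
Proof.
  destruct n.
  - split; auto. intros x y. apply continuity_2d_pt_id1.
  - apply (Ck_S n _ (fun _ _ => 1) (fun _ _ => 0)); try apply Ck_const;
      intros x y.
    + apply (is_derive_id (K := R_AbsRing)).
    + apply (is_derive_const (K := R_AbsRing) (V := R_NormedModule)).
Qed.

Lemma Ck_snd n : Ck n (fun _ y => y).
Proof.
  destruct n.
  - split; auto. intros x y. apply continuity_2d_pt_id2.
  - apply (Ck_S n _ (fun _ _ => 0) (fun _ _ => 1)); try apply Ck_const;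
      intros x y.
    + apply (is_derive_const (K := R_AbsRing) (V := R_NormedModule)).
    + apply (is_derive_id (K := R_AbsRing)).
Qed.

Lemma Ck_plus n f g : Ck n f -> Ck n g -> Ck n (fun x y => f x y + g x y).
Proof.
  revert f g. induction n as [|n IH]; intros f g.
  - intros [Hf _] [Hg _]. split; auto. intros x y.
    now apply continuity_2d_pt_plus.
  - intros [_ [f1 [f2 [F1 [F2 [Cf1 Cf2]]]]]] [_ [g1 [g2 [G1 [G2 [Cg1 Cg2]]]]]].
    apply (Ck_S n _ (fun x y => f1 x y + g1 x y) (fun x y => f2 x y + g2 x y));
      auto; intros x y.
    + apply (is_derive_plus (K := R_AbsRing) (V := R_NormedModule)
        (fun z => f z y) (fun z => g z y)); auto.
    + apply (is_derive_plus (K := R_AbsRing) (V := R_NormedModule)); auto.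
Qed.

Lemma Ck_mult n f g : Ck n f -> Ck n g -> Ck n (fun x y => f x y * g x y).
Proof.
  revert f g. induction n as [|n IH]; intros f g.
  - intros [Hf _] [Hg _]. split; auto. intros x y.
    now apply continuity_2d_pt_mult.
  - intros Hf Hg. pose proof (Ck_down _ _ Hf) as Df.
    pose proof (Ck_down _ _ Hg) as Dg.
    destruct Hf as [_ [f1 [f2 [F1 [F2 [Cf1 Cf2]]]]]].
    destruct Hg as [_ [g1 [g2 [G1 [G2 [Cg1 Cg2]]]]]].
    apply (Ck_S n _ (fun x y => f1 x y * g x y + f x y * g1 x y)
      (fun x y => f2 x y * g x y + f x y * g2 x y));
      try (apply Ck_plus; apply IH; assumption); intros x y.
    + apply (is_derive_mult (K := R_AbsRing) (fun z => f z y) (fun z => g z y));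
        auto. apply Rmult_comm.
    + apply (is_derive_mult (K := R_AbsRing)); auto. apply Rmult_comm.
Qed.

Lemma Ck_opp n f : Ck n f -> Ck n (fun x y => - f x y).
Proof.
  intros H. replace (fun x y => - f x y) with (fun x y => (-1) * f x y).
  - apply (Ck_mult n (fun _ _ => -1)); auto. apply Ck_const.
  - extensionality x. extensionality y. ring.
Qed.

Lemma Ck_minus n f g : Ck n f -> Ck n g -> Ck n (fun x y => f x y - g x y).
Proof.
  intros Hf Hg. apply (Ck_plus n f (fun x y => - g x y)); auto.
  now apply Ck_opp.
Qed.

(** The partial derivatives of the composite only involve first derivatives of the
    three functions and the inner functions themselves, one order lower: the induction
    closes with [Ck_mult] and [Ck_plus]. *)
Lemma Ck_comp n F A B :
  Ck n F -> Ck n A -> Ck n B -> Ck n (fun x y => F (A x y) (B x y)).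
Proof.
  revert F A B. induction n as [|n IH]; intros F A B HF HA HB.
  - split; auto. intros x y. apply continuity_2d_comp.
    + now apply (Ck_continuity 0).
    + now apply (Ck_continuity 0).
    + now apply (Ck_continuity 0).
  - pose proof (Ck_down _ _ HA) as DA. pose proof (Ck_down _ _ HB) as DB.
    destruct HF as [_ [F1 [F2 [dF1 [dF2 [CF1 CF2]]]]]].
    destruct HA as [_ [A1 [A2 [dA1 [dA2 [CA1 CA2]]]]]].
    destruct HB as [_ [B1 [B2 [dB1 [dB2 [CB1 CB2]]]]]].
    apply (Ck_S n _
      (fun x y => F1 (A x y) (B x y) * A1 x y + F2 (A x y) (B x y) * B1 x y)
      (fun x y => F1 (A x y) (B x y) * A2 x y + F2 (A x y) (B x y) * B2 x y)).
    + intros x y.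
      apply (is_derive_comp_2d F F1 F2 (fun z => A z y) (fun z => B z y)); auto.
      apply (Ck_continuity n _ CF1).
    + intros x y.
      apply (is_derive_comp_2d F F1 F2 (A x) (B x)); auto.
      apply (Ck_continuity n _ CF1).
    + apply Ck_plus; apply Ck_mult; auto.
    + apply Ck_plus; apply Ck_mult; auto.
Qed.

Lemma Ck_inv n f : (forall x y, f x y <> 0) -> Ck n f ->
  Ck n (fun x y => / f x y).
Proof.
  intros Hne. revert n. induction n as [|n IH]; intros Hf.
  - split; auto. intros x y. apply continuity_2d_pt_inv; auto.
    now apply (Ck_continuity 0).
  - pose proof (IH (Ck_down _ _ Hf)) as Di.
    destruct Hf as [_ [f1 [f2 [dF1 [dF2 [C1 C2]]]]]].
    apply (Ck_S n _ (fun x y => - f1 x y * (/ f x y * / f x y))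
      (fun x y => - f2 x y * (/ f x y * / f x y))).
    + intros x y. eapply is_derive_eq.
      * apply (is_derive_inv (fun z => f z y)); auto.
      * simpl. field. apply Hne.
    + intros x y. eapply is_derive_eq.
      * apply (is_derive_inv (f x)); auto.
      * simpl. field. apply Hne.
    + apply (Ck_mult n (fun x y => - f1 x y) (fun x y => / f x y * / f x y)).
      * now apply Ck_opp.
      * now apply Ck_mult.
    + apply (Ck_mult n (fun x y => - f2 x y) (fun x y => / f x y * / f x y)).
      * now apply Ck_opp.
      * now apply Ck_mult.
Qed.

Lemma Ck_exp n f : Ck n f -> Ck n (fun x y => exp (f x y)).
Proof.
  induction n as [|n IH]; intros Hf.
  - split; auto. intros x y.
    apply (continuity_2d_comp (fun a _ => exp a) f f); try now apply (Ck_continuity 0).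
    apply continuity_2d_fst. apply (is_derive_continuity_pt _ _ _ (is_derive_exp _)).
  - pose proof (IH (Ck_down _ _ Hf)) as De.
    destruct Hf as [_ [f1 [f2 [dF1 [dF2 [C1 C2]]]]]].
    apply (Ck_S n _ (fun x y => f1 x y * exp (f x y))
      (fun x y => f2 x y * exp (f x y))); try (now apply Ck_mult); intros x y.
    + apply (is_derive_comp exp (fun z => f z y)); auto. apply is_derive_exp.
    + apply (is_derive_comp exp (f x)); auto. apply is_derive_exp.
Qed.

(** A change of t alters the integrand uniformly little on a compact
    interval; a change of the upper bound x is controlled at a fixed t. *)
Lemma RInt_param_continuous (k : R -> R -> R) :
  (forall x y, continuity_2d_pt k x y) ->
  forall t x, continuity_2d_pt (fun t x => RInt (k t) 0 x) t x.
Proof.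
  intros Hk t0 x0 eps.
  assert (Hs : forall t s, continuous (k t) s)
    by (intros; now apply continuity_2d_slice).
  set (b := Rabs x0 + 1).
  assert (Hb : 0 < b) by (unfold b; pose proof (Rabs_pos x0); lra).
  assert (He : 0 < eps / (2 * b)).
  { apply Rdiv_lt_0_compat; [apply cond_pos | lra]. }
  destruct (uniform_continuity_2d_1d' k (- b) b t0
    (fun x _ => Hk t0 x) (mkposreal _ He)) as [d Hd].
  assert (Hp : continuity_pt (fun z => RInt (k t0) 0 z) x0).
  { apply (is_derive_continuity_pt _ _ (k t0 x0)). now apply is_derive_RInt_R. }
  assert (He2 : 0 < eps / 2) by (pose proof (cond_pos eps); lra).
  destruct (proj1 (continuity_pt_locally _ _) Hp (mkposreal _ He2)) as [d2 Hd2].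
  assert (Hd3 : 0 < Rmin 1 (Rmin d d2)).
  { apply Rmin_case; [lra |]. apply Rmin_case; apply cond_pos. }
  exists (mkposreal _ Hd3). intros t x Ht Hx. simpl in Ht, Hx.
  assert (M1 := Rmin_l 1 (Rmin d d2)).
  assert (M2 := Rmin_r 1 (Rmin d d2)).
  assert (M3 := Rmin_l d d2). assert (M4 := Rmin_r d d2).
  replace (RInt (k t) 0 x - RInt (k t0) 0 x0) with
    ((RInt (k t) 0 x - RInt (k t0) 0 x)
     + (RInt (k t0) 0 x - RInt (k t0) 0 x0)) by ring.
  eapply Rle_lt_trans; [apply Rabs_triang |].
  assert (Hxb : Rabs x <= b).
  { unfold b. replace x with (x0 + (x - x0)) by ring.
    eapply Rle_trans; [apply Rabs_triang |]. lra. }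
  assert (B1 : Rabs (RInt (k t) 0 x - RInt (k t0) 0 x) <= eps / 2).
  { replace (RInt (k t) 0 x - RInt (k t0) 0 x)
      with (RInt (fun s => k t s - k t0 s) 0 x).
    2:{ apply (RInt_minus (V := R_CompleteNormedModule));
        apply ex_RInt_R; auto. }
    eapply Rle_trans.
    - apply (RInt_bound _ _ _ (eps / (2 * b))).
      + intros s. apply (continuous_minus (V := R_NormedModule)); auto.
      + intros s Hss. left.
        assert (- b <= s <= b).
        { apply Rabs_le_between in Hxb. revert Hss.
          unfold Rmin, Rmax. destruct (Rle_dec 0 x); lra. }
        pose proof (cond_pos d).
        apply Rabs_lt_between in Ht.
        apply (Hd s t0 s t); try lra.
        replace (s - s) with 0 by ring. rewrite Rabs_R0. lra.
    - rewrite Rminus_0_r. pose proof (cond_pos eps).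
      replace (eps / 2) with (eps / (2 * b) * b) by (field; lra).
      apply Rmult_le_compat_l; [left; exact He | exact Hxb]. }
  assert (B2 : Rabs (RInt (k t0) 0 x - RInt (k t0) 0 x0) < eps / 2).
  { apply (Hd2 x). unfold ball; simpl. unfold AbsRing_ball; simpl.
    unfold abs, minus, plus, opp; simpl. unfold Rminus in Hx. lra. }
  lra.
Qed.

(** The partial derivatives of the integral are the integral of the first
    partial derivative of k, and k itself. *)
Lemma Ck_RInt n k : Ck n k -> Ck n (fun t x => RInt (k t) 0 x).
Proof.
  revert k. induction n as [|n IH]; intros k Hk.
  - split; auto. apply RInt_param_continuous. now apply (Ck_continuity 0).
  - pose proof (Ck_down _ _ Hk) as Dk.
    destruct Hk as [Hc [k1 [k2 [d1 [d2 [C1 C2]]]]]].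
    assert (Hs : forall t s, continuous (k t) s)
      by (intros; now apply continuity_2d_slice).
    apply (Ck_S n _ (fun t x => RInt (k1 t) 0 x) k); auto.
    + intros t x.
      assert (E : forall s, Derive (fun u => k u s) t = k1 t s)
        by (intros; now apply is_derive_unique).
      rewrite <- (RInt_ext (fun s => Derive (fun u => k u s) t)) by auto.
      apply is_derive_RInt_param.
      * exists (mkposreal 1 Rlt_0_1). intros u _ s _. now exists (k1 u s).
      * intros s _. apply continuity_2d_pt_ext with k1.
        -- intros; symmetry; now apply is_derive_unique.
        -- now apply (Ck_continuity n).
      * exists (mkposreal 1 Rlt_0_1). intros u _.
        apply ex_RInt_R; auto.
    + intros t x. now apply is_derive_RInt_R.
Qed.

(** * Flows of bounded locally Lipschitz fields on the line *)

(** Comparison of two functions through their derivatives, whatever the position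
    of s with respect to a: it replaces estimates of integrals of absolute values. *)
Lemma derive_compare (f f' g g' : R -> R) (a s : R) :
  (forall x, is_derive f x (f' x)) -> (forall x, is_derive g x (g' x)) ->
  (forall x, Rmin a s <= x <= Rmax a s -> Rabs (f' x) <= g' x) ->
  Rabs (f s - f a) <= Rabs (g s - g a).
Proof.
  intros Hf Hg Hle.
  destruct (MVT_gen (fun x => f x - g x) a s (fun x => f' x - g' x))
    as [c [Hc Ec]].
  { intros x _. apply (is_derive_minus (K := R_AbsRing) (V := R_NormedModule));
      auto. }
  { intros x _. apply (is_derive_continuity_pt _ _ (f' x - g' x)).
    apply (is_derive_minus (K := R_AbsRing) (V := R_NormedModule)); auto. }
  destruct (MVT_gen (fun x => f x + g x) a s (fun x => f' x + g' x))
    as [d [Hd Ed]].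
  { intros x _. apply (is_derive_plus (K := R_AbsRing) (V := R_NormedModule));
      auto. }
  { intros x _. apply (is_derive_continuity_pt _ _ (f' x + g' x)).
    apply (is_derive_plus (K := R_AbsRing) (V := R_NormedModule)); auto. }
  apply Hle in Hc. apply Hle in Hd.
  apply Rabs_le_between in Hc. apply Rabs_le_between in Hd.
  destruct (Rle_dec a s) as [H | H].
  - apply Rle_trans with (g s - g a); [| apply Rle_abs].
    apply Rabs_le. nra.
  - rewrite <- (Rabs_Ropp (g s - g a)).
    apply Rle_trans with (- (g s - g a)); [| apply Rle_abs].
    apply Rabs_le. nra.
Qed.

Lemma geom_half_lt (C eps : R) : 0 < eps -> exists n, C * (/ 2) ^ n < eps.
Proof.
  intros He.
  destruct (pow_lt_1_zero (/ 2)) with (y := eps / (Rabs C + 1)) as [n Hn].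
  - rewrite Rabs_right; lra.
  - apply Rdiv_lt_0_compat; auto. pose proof (Rabs_pos C); lra.
  - exists n. specialize (Hn n (Nat.le_refl n)).
    pose proof (Rabs_pos C). pose proof (Rle_abs C).
    assert (0 < (/ 2) ^ n) by (apply pow_lt; lra).
    rewrite Rabs_right in Hn by lra.
    apply (Rmult_lt_compat_r (Rabs C + 1)) in Hn; [| lra].
    replace (eps / (Rabs C + 1) * (Rabs C + 1)) with eps in Hn by (field; lra).
    nra.
Qed.

Lemma le_geom (a b C : R) : (forall n, a <= b + C * (/ 2) ^ n) -> a <= b.
Proof.
  intros H. apply Rnot_lt_le. intros Hlt.
  destruct (geom_half_lt C (a - b)) as [n Hn]; [lra |].
  specialize (H n). lra.
Qed.

(** The increments are summable, hence the sequence is Cauchy, and the tail of the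
    geometric series bounds the distance to the limit. *)
Lemma geometric_limit (u : nat -> R) (C : R) :
  (forall n, Rabs (u (S n) - u n) <= C * (/ 2) ^ n) ->
  forall n, Rabs (real (Lim_seq u) - u n) <= 2 * C * (/ 2) ^ n.
Proof.
  intros H.
  assert (HC : 0 <= C).
  { specialize (H O). simpl in H. pose proof (Rabs_pos (u 1%nat - u O)). lra. }
  assert (D : forall n m,
    Rabs (u (n + m)%nat - u n) <= 2 * C * ((/ 2) ^ n - (/ 2) ^ (n + m))).
  { intros n m. induction m as [|m IH].
    - rewrite Nat.add_0_r.
      replace (u n - u n) with 0 by ring. rewrite Rabs_R0. lra.
    - rewrite Nat.add_succ_r.
      replace (u (S (n + m)) - u n)
        with ((u (S (n + m)) - u (n + m)%nat) + (u (n + m)%nat - u n)) by ring.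
      eapply Rle_trans; [apply Rabs_triang |].
      specialize (H (n + m)%nat). simpl. lra. }
  assert (D' : forall n m, (n <= m)%nat ->
    Rabs (u m - u n) <= 2 * C * (/ 2) ^ n).
  { intros n m Hnm. replace m with (n + (m - n))%nat by lia.
    eapply Rle_trans; [apply D |].
    assert (0 < (/ 2) ^ (n + (m - n))) by (apply pow_lt; lra). nra. }
  assert (L : is_lim_seq u (real (Lim_seq u))).
  { apply (Lim_seq_correct' u). apply ex_lim_seq_cauchy_corr.
    intros eps. destruct (geom_half_lt (4 * C) eps (cond_pos eps)) as [N HN].
    exists N. intros n m Hn Hm.
    replace (u n - u m) with ((u n - u N) - (u m - u N)) by ring.
    eapply Rle_lt_trans; [apply Rabs_triang |]. rewrite Rabs_Ropp.
    pose proof (D' N n Hn). pose proof (D' N m Hm). lra. }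
  intros n.
  apply (is_lim_seq_le_loc (fun m => Rabs (u m - u n))
    (fun _ => 2 * C * (/ 2) ^ n)
    (Rabs (real (Lim_seq u) - u n)) (2 * C * (/ 2) ^ n)).
  - exists n. intros m Hm. now apply D'.
  - apply (is_lim_seq_abs _ (Finite (real (Lim_seq u) - u n))).
    apply is_lim_seq_minus'; [exact L | apply is_lim_seq_const].
  - apply is_lim_seq_const.
Qed.

Definition locally_lipschitz (r : R -> R) : Prop :=
  forall A, exists K, 0 < K /\ forall x y, Rabs x <= A -> Rabs y <= A ->
    Rabs (r x - r y) <= K * Rabs (x - y).

Definition solution (r X : R -> R) : Prop :=
  forall s, is_derive X s (r (X s)).

Lemma continuous_bounded (f : R -> R) (A : R) :
  (forall x, continuity_pt f x) ->
  exists B, 0 < B /\ forall x, Rabs x <= A -> Rabs (f x) <= B.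
Proof.
  intros Hf.
  destruct (bounded_continuity (V := R_NormedModule) f (- A) A) as [B HB].
  { intros x _. apply continuity_pt_filterlim. apply Hf. }
  exists (Rmax 1 B). split.
  - apply Rlt_le_trans with 1; [lra | apply Rmax_l].
  - intros x Hx. apply Rle_trans with B; [| apply Rmax_r]. left. apply HB.
    now apply Rabs_le_between.
Qed.

Lemma between_abs (a b c A : R) :
  Rmin a b <= c <= Rmax a b -> Rabs a <= A -> Rabs b <= A -> Rabs c <= A.
Proof.
  intros Hc Ha Hb. apply Rabs_le. apply Rabs_le_between in Ha.
  apply Rabs_le_between in Hb. revert Hc. unfold Rmin, Rmax.
  destruct (Rle_dec a b); lra.
Qed.

Lemma mean_value (f f' : R -> R) (a b : R) :
  (forall x, is_derive f x (f' x)) ->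
  exists c, Rmin a b <= c <= Rmax a b /\ f b - f a = f' c * (b - a).
Proof.
  intros H. apply MVT_gen; intros x _; auto.
  now apply (is_derive_continuity_pt _ _ (f' x)).
Qed.

Lemma locally_lipschitz_of_derive (r r1 : R -> R) :
  (forall x, is_derive r x (r1 x)) -> (forall x, continuity_pt r1 x) ->
  locally_lipschitz r.
Proof.
  intros H Hc A. destruct (continuous_bounded r1 A Hc) as [B [HB0 HB]].
  exists B. split; auto. intros x y Hx Hy.
  destruct (mean_value r r1 y x H) as [c [Hc1 ->]].
  rewrite Rabs_mult. apply Rmult_le_compat_r; [apply Rabs_pos |].
  apply HB. now apply (between_abs y x).
Qed.

(** Iterates for the initial value problem X' = r(X), X(0) = t. *)
Fixpoint picard (r : R -> R) (t : R) (n : nat) (s : R) : R :=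
  match n with
  | O => t
  | S m => t + RInt (fun z => r (picard r t m z)) 0 s
  end.

Definition flow (r : R -> R) (t s : R) : R :=
  real (Lim_seq (fun n => picard r t n s)).

Lemma continuous_comp_R (f g : R -> R) (x : R) :
  (forall y, continuity_pt f y) -> continuous g x ->
  continuous (fun z => f (g z)) x.
Proof.
  intros Hf Hg. apply (continuous_comp g f); auto.
  apply continuity_pt_filterlim. apply Hf.
Qed.

Lemma is_derive_shift_prim (f : R -> R) (t s : R) :
  (forall z, continuous f z) ->
  is_derive (fun s => t + RInt f 0 s) s (f s).
Proof.
  intros H. eapply is_derive_eq.
  - apply (is_derive_plus (K := R_AbsRing) (V := R_NormedModule)
      (fun _ => t) (fun s => RInt f 0 s)).
    + apply is_derive_const.
    + now apply is_derive_RInt_R.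
  - apply plus_zero_l.
Qed.

Lemma picard_continuous (r : R -> R) (t : R) (n : nat) :
  (forall y, continuity_pt r y) -> forall s, continuous (picard r t n) s.
Proof.
  intros Hr. induction n as [|n IH]; intros s.
  - apply continuous_const.
  - apply (ex_derive_continuous (K := R_AbsRing) (V := R_NormedModule)).
    eexists. apply (is_derive_shift_prim (fun z => r (picard r t n z))).
    intros z. now apply continuous_comp_R.
Qed.

Lemma RInt_Chasles_sub (f : R -> R) (a b c : R) :
  (forall s, continuous f s) -> RInt f a c - RInt f a b = RInt f b c.
Proof.
  intros H.
  assert (E : RInt f a b + RInt f b c = RInt f a c)
    by (apply (RInt_Chasles (V := R_CompleteNormedModule));
      apply ex_RInt_R; auto).
  rewrite <- E. ring.
Qed.

Lemma picard_lipschitz (r : R -> R) (M t : R) (n : nat) (s s' : R) :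
  (forall y, continuity_pt r y) -> (forall y, Rabs (r y) <= M) ->
  Rabs (picard r t n s - picard r t n s') <= M * Rabs (s - s').
Proof.
  intros Hr HM. destruct n as [|n]; simpl.
  - replace (t - t) with 0 by ring. rewrite Rabs_R0.
    apply Rmult_le_pos; [| apply Rabs_pos].
    apply Rle_trans with (2 := HM 0). apply Rabs_pos.
  - assert (Hc : forall z, continuous (fun z => r (picard r t n z)) z).
    { intros z. apply continuous_comp_R; auto. now apply picard_continuous. }
    replace (t + RInt (fun z => r (picard r t n z)) 0 s
      - (t + RInt (fun z => r (picard r t n z)) 0 s'))
      with (RInt (fun z => r (picard r t n z)) s' s).
    + apply RInt_bound; auto.
    + rewrite <- (RInt_Chasles_sub (fun z : R => r (picard r t n z)) 0 s' s Hc).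
      match goal with |- ?x = ?y => change (@eq R x y) end. ring.
Qed.

Lemma picard_zero (r : R -> R) (t : R) (n : nat) : picard r t n 0 = t.
Proof.
  destruct n; simpl; auto.
  rewrite (RInt_point (V := R_CompleteNormedModule)). apply Rplus_0_r.
Qed.

(** With the weight E(s) = e^(2Ks) + e^(-2Ks), where K is a Lipschitz constant of
    r on the interval that the iterates cannot leave before time S0, integration from 0 halves
    the weighted norm: a primitive of K E is (e^(2Ks) - e^(-2Ks)) / 2, of absolute value at
    most E/2. The symmetric weight treats both directions of time at once. *)
Lemma picard_contraction (r : R -> R) (M t : R) (S0 : R) :
  (forall y, continuity_pt r y) -> (forall y, Rabs (r y) <= M) ->
  locally_lipschitz r -> 0 <= S0 ->
  exists C, forall n s, Rabs s <= S0 ->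
    Rabs (picard r t (S n) s - picard r t n s) <= C * (/ 2) ^ n.
Proof.
  intros Hr HM Hlip HS.
  assert (HM0 : 0 <= M) by (apply Rle_trans with (2 := HM 0); apply Rabs_pos).
  destruct (Hlip (Rabs t + M * S0)) as [K [HK Hl]].
  set (E := fun s => exp (2 * K * s) + exp (- (2 * K * s))).
  set (G := fun s => (exp (2 * K * s) - exp (- (2 * K * s))) / (2 * K)).
  assert (HG : forall c s, is_derive (fun s => c * G s) s (c * E s)).
  { intros c s. unfold G, E. auto_derive; auto. field. lra. }
  assert (HGE : forall s, Rabs (G s) <= / (2 * K) * E s).
  { intros s. unfold G, E, Rdiv. rewrite Rabs_mult, Rmult_comm.
    assert (0 < / (2 * K)) by (apply Rinv_0_lt_compat; lra).
    rewrite (Rabs_right (/ (2 * K))) by lra.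
    apply Rmult_le_compat_l; [lra |].
    pose proof (exp_pos (2 * K * s)). pose proof (exp_pos (- (2 * K * s))).
    apply Rabs_le. lra. }
  assert (HE : forall s, 1 <= E s).
  { intros s. unfold E.
    pose proof (exp_ineq1_le (2 * K * s)).
    pose proof (exp_ineq1_le (- (2 * K * s))). lra. }
  assert (Hin : forall n s, Rabs s <= S0 ->
    Rabs (picard r t n s) <= Rabs t + M * S0).
  { intros n s Hs.
    replace (picard r t n s) with (t + (picard r t n s - picard r t n 0))
      by (rewrite picard_zero; ring).
    eapply Rle_trans; [apply Rabs_triang |]. apply Rplus_le_compat_l.
    eapply Rle_trans; [apply (picard_lipschitz r M); auto |].
    apply Rmult_le_compat_l; auto. now rewrite Rminus_0_r. }
  assert (W : forall n s, Rabs s <= S0 ->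
    Rabs (picard r t (S n) s - picard r t n s) <= M * S0 * (/ 2) ^ n * E s).
  { induction n as [|n IH]; intros s Hs.
    - replace (picard r t 0 s) with (picard r t 1 0)
        by (now rewrite picard_zero).
      eapply Rle_trans; [apply (picard_lipschitz r M); auto |].
      rewrite Rminus_0_r. simpl. rewrite Rmult_1_r.
      specialize (HE s).
      apply Rle_trans with (M * S0); [now apply Rmult_le_compat_l |].
      assert (0 <= M * S0) by (now apply Rmult_le_pos). nra.
    - set (c := K * (M * S0 * (/ 2) ^ n)).
      assert (Hp : forall m z, continuous (fun z => r (picard r t m z)) z).
      { intros m z. apply continuous_comp_R; auto. now apply picard_continuous. }
      pose proof (derive_compare
        (fun s => picard r t (S (S n)) s - picard r t (S n) s)
        (fun s => r (picard r t (S n) s) - r (picard r t n s))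
        (fun s => c * G s) (fun s => c * E s) 0 s) as Hcmp.
      assert (G0 : G 0 = 0).
      { unfold G. rewrite Rmult_0_r, Ropp_0. field. lra. }
      cbv beta in Hcmp. rewrite !picard_zero, G0, Rmult_0_r in Hcmp.
      replace (t - t) with 0 in Hcmp by ring. rewrite !Rminus_0_r in Hcmp.
      eapply Rle_trans; [apply Hcmp |].
      + intros x.
        apply (is_derive_minus (K := R_AbsRing) (V := R_NormedModule)).
        * apply (is_derive_shift_prim (fun z => r (picard r t (S n) z))); auto.
        * apply (is_derive_shift_prim (fun z => r (picard r t n z))); auto.
      + apply HG.
      + intros x Hx.
        assert (Hx' : Rabs x <= S0).
        { apply (between_abs 0 s); auto. now rewrite Rabs_R0. }
        unfold c. rewrite (Rmult_assoc K).
        eapply Rle_trans; [apply Hl; auto |].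
        apply Rmult_le_compat_l; [lra |]. now apply IH.
      + rewrite Rabs_mult.
        assert (0 <= M * S0 * (/ 2) ^ n).
        { apply Rmult_le_pos; [now apply Rmult_le_pos |]. apply pow_le; lra. }
        rewrite (Rabs_right c) by (unfold c; nra).
        apply Rle_trans with (c * (/ (2 * K) * E s)).
        * apply Rmult_le_compat_l; auto. unfold c; nra.
        * unfold c. simpl. right. field. lra. }
  exists (M * S0 * (2 * exp (2 * K * S0))). intros n s Hs.
  eapply Rle_trans; [now apply W |].
  assert (0 <= M * S0 * (/ 2) ^ n).
  { apply Rmult_le_pos; [now apply Rmult_le_pos |]. apply pow_le; lra. }
  assert (E s <= 2 * exp (2 * K * S0)).
  { apply Rabs_le_between in Hs. unfold E.
    assert (exp (2 * K * s) <= exp (2 * K * S0)).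
    { destruct (Req_dec s S0) as [-> | Hne]; [lra |].
      left. apply exp_increasing. nra. }
    assert (exp (- (2 * K * s)) <= exp (2 * K * S0)).
    { destruct (Req_dec s (- S0)) as [-> | Hne].
      - right. f_equal. ring.
      - left. apply exp_increasing. nra. }
    lra. }
  nra.
Qed.

Lemma flow_limit (r : R -> R) (M t S0 : R) :
  (forall y, continuity_pt r y) -> (forall y, Rabs (r y) <= M) ->
  locally_lipschitz r -> 0 <= S0 ->
  exists C, forall n s, Rabs s <= S0 ->
    Rabs (flow r t s - picard r t n s) <= C * (/ 2) ^ n.
Proof.
  intros Hr HM Hlip HS.
  destruct (picard_contraction r M t S0 Hr HM Hlip HS) as [C HC].
  exists (2 * C). intros n s Hs.
  apply (geometric_limit (fun n => picard r t n s)). auto.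
Qed.

(** All iterates are M-Lipschitz, hence so is their limit; this gives the
    continuity needed to integrate r along the limit. *)
Lemma flow_lipschitz_time (r : R -> R) (M t s s' : R) :
  (forall y, continuity_pt r y) -> (forall y, Rabs (r y) <= M) ->
  locally_lipschitz r ->
  Rabs (flow r t s - flow r t s') <= M * Rabs (s - s').
Proof.
  intros Hr HM Hlip.
  destruct (flow_limit r M t (Rmax (Rabs s) (Rabs s')) Hr HM Hlip) as [C HC].
  { apply Rle_trans with (Rabs s); [apply Rabs_pos | apply Rmax_l]. }
  apply (le_geom _ _ (2 * C)). intros n.
  pose proof (HC n s (Rmax_l _ _)) as H1.
  pose proof (HC n s' (Rmax_r _ _)) as H2.
  pose proof (picard_lipschitz r M t n s s' Hr HM) as H3.
  apply Rabs_le_between in H1. apply Rabs_le_between in H2.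
  apply Rabs_le_between in H3. apply Rabs_le. lra.
Qed.

Lemma continuous_of_lipschitz (f : R -> R) (M s : R) :
  (forall s s', Rabs (f s - f s') <= M * Rabs (s - s')) -> continuous f s.
Proof.
  intros H. apply continuity_pt_filterlim. apply continuity_pt_locally.
  intros eps.
  assert (Hd : 0 < eps / (Rabs M + 1)).
  { apply Rdiv_lt_0_compat; [apply cond_pos |]. pose proof (Rabs_pos M); lra. }
  exists (mkposreal _ Hd). intros y Hy.
  change (Rabs (y - s) < eps / (Rabs M + 1)) in Hy.
  eapply Rle_lt_trans; [apply H |].
  pose proof (Rabs_pos M). pose proof (Rle_abs M). pose proof (Rabs_pos (y - s)).
  apply (Rmult_lt_compat_r (Rabs M + 1)) in Hy; [| lra].
  replace (eps / (Rabs M + 1) * (Rabs M + 1)) with (pos eps) in Hy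
    by (field; lra).
  nra.
Qed.

(** An orbit of a bounded field stays in a compact set for bounded times, so that a
    local Lipschitz constant is enough to pass to the limit in the iteration, and the solution is
    global. *)
Lemma flow_solution (r : R -> R) (M t : R) :
  (forall y, continuity_pt r y) -> (forall y, Rabs (r y) <= M) ->
  locally_lipschitz r -> solution r (flow r t) /\ flow r t 0 = t.
Proof.
  intros Hr HM Hlip.
  assert (Hc : forall z, continuous (fun z => r (flow r t z)) z).
  { intros z. apply continuous_comp_R; auto. apply (continuous_of_lipschitz _ M).
    intros s s'. now apply flow_lipschitz_time. }
  assert (Heq : forall s, flow r t s = t + RInt (fun z => r (flow r t z)) 0 s).
  { intros s.
    destruct (flow_limit r M t (Rabs s) Hr HM Hlip (Rabs_pos s)) as [C HC].
    destruct (Hlip (Rabs t + M * Rabs s + Rabs C)) as [K [HK Hl]].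
    apply Rminus_diag_uniq.
    assert (Hz : Rabs (flow r t s - (t + RInt (fun z => r (flow r t z)) 0 s))
      <= 0).
    2:{ pose proof (Rabs_pos (flow r t s
          - (t + RInt (fun z => r (flow r t z)) 0 s))).
        apply Rabs_eq_0. lra. }
    apply (le_geom _ _ (C + K * C * Rabs s)). intros n.
    replace (flow r t s - (t + RInt (fun z => r (flow r t z)) 0 s))
      with ((flow r t s - picard r t (S n) s)
        + RInt (fun z => r (picard r t n z) - r (flow r t z)) 0 s).
    2:{ rewrite (RInt_minus (V := R_CompleteNormedModule)
          (fun z => r (picard r t n z)) (fun z => r (flow r t z))).
        - simpl. unfold minus, plus, opp; simpl. ring.
        - apply ex_RInt_R. intros z. apply continuous_comp_R; auto.
          now apply picard_continuous.
        - now apply ex_RInt_R. }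
    eapply Rle_trans; [apply Rabs_triang |].
    assert (0 < (/ 2) ^ n <= 1).
    { split; [apply pow_lt; lra |]. rewrite <- (pow1 n). apply pow_incr. lra. }
    assert (HC0 : 0 <= C * (/ 2) ^ n).
    { eapply Rle_trans; [| apply (HC n s)]; [apply Rabs_pos | lra]. }
    assert (Hpos : 0 <= C) by nra.
    assert (P1 := HC (S n) s (Rle_refl _)). simpl in P1.
    assert (P2 : Rabs (RInt (fun z => r (picard r t n z) - r (flow r t z)) 0 s)
      <= K * (C * (/ 2) ^ n) * Rabs (s - 0)).
    { apply RInt_bound.
      - intros z. apply (continuous_minus (V := R_NormedModule)); auto.
        apply continuous_comp_R; auto. now apply picard_continuous.
      - intros z Hz.
        assert (Hzs : Rabs z <= Rabs s).
        { apply (between_abs 0 s); auto; try lra. rewrite Rabs_R0.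
          apply Rabs_pos. }
        assert (HM0 : 0 <= M)
          by (apply Rle_trans with (2 := HM 0); apply Rabs_pos).
        assert (Hp : Rabs (picard r t n z) <= Rabs t + M * Rabs s).
        { replace (picard r t n z) with (t + (picard r t n z - picard r t n 0))
            by (rewrite picard_zero; ring).
          eapply Rle_trans; [apply Rabs_triang |]. apply Rplus_le_compat_l.
          eapply Rle_trans; [apply (picard_lipschitz r M); auto |].
          rewrite Rminus_0_r. now apply Rmult_le_compat_l. }
        specialize (HC n z Hzs).
        eapply Rle_trans; [apply Hl |].
        + pose proof (Rabs_pos C). lra.
        + replace (flow r t z) with
            (picard r t n z + (flow r t z - picard r t n z)) by ring.
          eapply Rle_trans; [apply Rabs_triang |].
          pose proof (Rle_abs C). nra.
        + apply Rmult_le_compat_l; [lra |]. now rewrite Rabs_minus_sym. }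
    rewrite Rminus_0_r in P2. clear - P1 P2 HC0.
    set (q := (/ 2) ^ n) in *.
    replace (0 + (C + K * C * Rabs s) * q)
      with (C * q + K * (C * q) * Rabs s) by ring.
    apply Rplus_le_compat; [| exact P2].
    eapply Rle_trans; [exact P1 |]. lra. }
  split.
  - intros s. apply (is_derive_ext
      (fun s => t + RInt (fun z => r (flow r t z)) 0 s)).
    + intros z. symmetry. apply Heq.
    + apply (is_derive_shift_prim (fun z => r (flow r t z))); auto.
  - rewrite Heq, (RInt_point (V := R_CompleteNormedModule)). apply Rplus_0_r.
Qed.

Lemma solution_lipschitz (r : R -> R) (M : R) (X : R -> R) (s : R) :
  (forall y, Rabs (r y) <= M) -> solution r X ->
  Rabs (X s - X 0) <= M * Rabs s.
Proof.
  intros HM HX. destruct (mean_value X (fun s => r (X s)) 0 s HX) as [c [_ ->]].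
  rewrite Rabs_mult, Rminus_0_r. apply Rmult_le_compat_r; auto.
  apply Rabs_pos.
Qed.

Lemma nonincreasing_of_derive (f f' : R -> R) (a b : R) : a <= b ->
  (forall x, is_derive f x (f' x)) ->
  (forall x, a <= x <= b -> f' x <= 0) -> f b <= f a.
Proof.
  intros Hab Hf Hn. destruct (mean_value f f' a b Hf) as [c [Hc E]].
  rewrite Rmin_left, Rmax_right in Hc by lra. specialize (Hn c Hc). nra.
Qed.

(** The squared distance of two solutions, multiplied by e^(-2Ks), decreases in s as
    long as both stay where K is a Lipschitz constant of r; multiplied by e^(2Ks), it increases. *)
Lemma gronwall (r : R -> R) (M A S0 : R) :
  (forall y, Rabs (r y) <= M) -> locally_lipschitz r ->
  0 <= S0 ->
  exists L, 0 < L /\ forall X Y, solution r X -> solution r Y ->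
    Rabs (X 0) <= A -> Rabs (Y 0) <= A -> forall s, Rabs s <= S0 ->
    Rabs (X s - Y s) <= L * Rabs (X 0 - Y 0).
Proof.
  intros HM Hlip HS.
  destruct (Hlip (A + M * S0)) as [K [HK Hl]].
  exists (exp (K * S0)). split; [apply exp_pos |].
  intros X Y HX HY HX0 HY0 s Hs.
  assert (HM0 : 0 <= M) by (apply Rle_trans with (2 := HM 0); apply Rabs_pos).
  assert (Hin : forall Z z, solution r Z -> Rabs (Z 0) <= A -> Rabs z <= S0 ->
    Rabs (Z z) <= A + M * S0).
  { intros Z z HZ HZ0 Hz. replace (Z z) with (Z 0 + (Z z - Z 0)) by ring.
    eapply Rle_trans; [apply Rabs_triang |].
    pose proof (solution_lipschitz r M Z z HM HZ).
    pose proof (Rmult_le_compat_l M _ _ HM0 Hz). lra. }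
  assert (Hd : forall c z, is_derive (fun z => (X z - Y z) ^ 2 * exp (c * z)) z
    ((2 * (X z - Y z) * (r (X z) - r (Y z)) + c * (X z - Y z) ^ 2)
      * exp (c * z))).
  { intros c z. pose proof (HX z) as DX. pose proof (HY z) as DY.
    auto_derive.
    - repeat split; eexists; eauto.
    - change (fun x : R => X x) with X. change (fun x : R => Y x) with Y.
      rewrite (is_derive_unique X z _ DX), (is_derive_unique Y z _ DY).
      ring. }
  assert (Hb : forall z, Rabs z <= S0 ->
    Rabs ((X z - Y z) * (r (X z) - r (Y z))) <= K * (X z - Y z) ^ 2).
  { intros z Hz. rewrite Rabs_mult, <- (pow2_abs (X z - Y z)).
    pose proof (Hl (X z) (Y z) (Hin X z HX HX0 Hz) (Hin Y z HY HY0 Hz)).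
    pose proof (Rabs_pos (X z - Y z)). nra. }
  assert (Hsq : (X s - Y s) ^ 2 <= (X 0 - Y 0) ^ 2 * exp (2 * K * Rabs s)).
  { pose proof Hs as Hs'. apply Rabs_le_between in Hs'.
    destruct (Rle_dec 0 s) as [H0 | H0].
    - rewrite (Rabs_right s) by lra.
      pose proof (nonincreasing_of_derive _ _ 0 s H0 (Hd (- (2 * K)))) as Hm.
      cbv beta in Hm. rewrite !Rmult_0_r, exp_0, Rmult_1_r in Hm.
      assert (Hm' : (X s - Y s) ^ 2 * exp (- (2 * K) * s) <= (X 0 - Y 0) ^ 2).
      { apply Hm. intros z Hz.
        assert (Hz' : Rabs z <= S0) by (apply Rabs_le; lra).
        specialize (Hb z Hz'). apply Rabs_le_between in Hb.
        pose proof (exp_pos (- (2 * K) * z)). nra. }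
      replace ((X s - Y s) ^ 2)
        with ((X s - Y s) ^ 2 * exp (- (2 * K) * s) * exp (2 * K * s)).
      + apply Rmult_le_compat_r; auto. left; apply exp_pos.
      + rewrite Rmult_assoc, <- exp_plus.
        replace (- (2 * K) * s + 2 * K * s) with 0 by ring.
        rewrite exp_0. ring.
    - rewrite (Rabs_left s) by lra.
      assert (Hn : forall z, is_derive
        (fun z => - ((X z - Y z) ^ 2 * exp (2 * K * z))) z
        (- ((2 * (X z - Y z) * (r (X z) - r (Y z)) + 2 * K * (X z - Y z) ^ 2)
      * exp (2 * K * z)))).
      { intros z. apply (is_derive_opp (K := R_AbsRing) (V := R_NormedModule)
          (fun z => (X z - Y z) ^ 2 * exp (2 * K * z))). apply Hd. }
      assert (H0' : s <= 0) by lra.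
      pose proof (nonincreasing_of_derive _ _ s 0 H0' Hn) as Hm.
      cbv beta in Hm. rewrite !Rmult_0_r, exp_0, Rmult_1_r in Hm.
      assert (Hm' : (X s - Y s) ^ 2 * exp (2 * K * s) <= (X 0 - Y 0) ^ 2).
      { apply Ropp_le_cancel, Hm. intros z Hz.
        assert (Hz' : Rabs z <= S0) by (apply Rabs_le; lra).
        specialize (Hb z Hz'). apply Rabs_le_between in Hb.
        pose proof (exp_pos (2 * K * z)). nra. }
      replace ((X s - Y s) ^ 2)
        with ((X s - Y s) ^ 2 * exp (2 * K * s) * exp (2 * K * - s)).
      + apply Rmult_le_compat_r; auto. left; apply exp_pos.
      + rewrite Rmult_assoc, <- exp_plus.
        replace (2 * K * s + 2 * K * - s) with 0 by ring.
        rewrite exp_0. ring. }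
  rewrite <- (Rabs_right (exp (K * S0))) by (left; apply exp_pos).
  rewrite <- Rabs_mult. apply Rsqr_le_abs_0. unfold Rsqr.
  simpl in Hsq. rewrite !Rmult_1_r in Hsq.
  eapply Rle_trans; [exact Hsq |].
  replace (exp (K * S0) * (X 0 - Y 0) * (exp (K * S0) * (X 0 - Y 0)))
    with ((X 0 - Y 0) * (X 0 - Y 0) * exp (2 * K * S0)).
  - apply Rmult_le_compat_l; [apply (Rle_0_sqr (X 0 - Y 0)) |].
    destruct Hs as [Hs | ->]; [| lra].
    left. apply exp_increasing, Rmult_lt_compat_l; lra.
  - replace (2 * K * S0) with (K * S0 + K * S0) by ring.
    rewrite exp_plus. ring.
Qed.

Lemma solution_unique (r : R -> R) (M : R) (X Y : R -> R) :
  (forall y, Rabs (r y) <= M) -> locally_lipschitz r ->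
  solution r X -> solution r Y -> X 0 = Y 0 -> forall s, X s = Y s.
Proof.
  intros HM Hlip HX HY H0 s.
  destruct (gronwall r M (Rabs (X 0)) (Rabs s) HM Hlip (Rabs_pos s))
    as [L [_ HL]].
  specialize (HL X Y HX HY (Rle_refl _)). rewrite <- H0 in HL.
  specialize (HL (Rle_refl _) s (Rle_refl _)).
  replace (X 0 - X 0) with 0 in HL by ring.
  rewrite Rabs_R0, Rmult_0_r in HL.
  pose proof (Rabs_pos (X s - Y s)). apply Rminus_diag_uniq, Rabs_eq_0. lra.
Qed.

(** * Smooth dependence of the flow on time and initial point *)

(** The derivative found at each order n is the same function, so that it is
    smooth as a whole. *)
Lemma smooth_partial_fst f : smooth f ->
  exists f1, smooth f1 /\ forall x y, is_derive (fun z => f z y) x (f1 x y).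
Proof.
  intros H. exists (fun u v => Derive (fun z => f z v) u).
  assert (Hd : forall x y,
    is_derive (fun z => f z y) x (Derive (fun z => f z y) x)).
  { intros x y. destruct (H 1%nat) as [_ [f1 [f2 [H1 _]]]].
    apply Derive_correct. now exists (f1 x y). }
  split; auto. intros n. destruct (H (S n)) as [_ [f1 [f2 [H1 [_ [C1 _]]]]]].
  replace (fun u v => Derive (fun z => f z v) u) with f1; auto.
  extensionality u. extensionality v. symmetry. now apply is_derive_unique.
Qed.

Definition smooth1 (r : R -> R) : Prop := smooth (fun x _ => r x).

Lemma smooth1_derive r : smooth1 r ->
  exists r1, smooth1 r1 /\ forall x, is_derive r x (r1 x).
Proof.
  intros H. destruct (smooth_partial_fst _ H) as [f1 [S1 D1]].
  exists (fun x => f1 x 0). split.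
  - intros n. apply (Ck_comp n f1 (fun x _ => x) (fun _ _ => 0)).
    + apply S1.
    + apply Ck_fst.
    + apply Ck_const.
  - intros x. apply (D1 x 0).
Qed.

Lemma smooth1_continuity r : smooth1 r -> forall x, continuity_pt r x.
Proof.
  intros H x. destruct (smooth1_derive r H) as [r1 [_ D]].
  now apply (is_derive_continuity_pt _ _ (r1 x)).
Qed.

Lemma smooth1_lipschitz r : smooth1 r -> locally_lipschitz r.
Proof.
  intros H. destruct (smooth1_derive r H) as [r1 [S1 D]].
  apply (locally_lipschitz_of_derive r r1); auto.
  now apply smooth1_continuity.
Qed.

Lemma smooth1_after_smooth r f : smooth1 r -> smooth f -> smooth (fun x y => r (f x y)).
Proof.
  intros Hr Hf n.
  apply (Ck_comp n (fun x _ => r x) f (fun _ _ => 0)); auto. apply Ck_const.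
Qed.

(** A quadratic remainder on a fixed neighbourhood is the form in which the
    differentiability of the flow is obtained. *)
Lemma is_derive_quadratic (f : R -> R) (t l C : R) :
  (forall t', Rabs (t' - t) <= 1 ->
    Rabs (f t' - f t - l * (t' - t)) <= C * (t' - t) ^ 2) ->
  is_derive f t l.
Proof.
  intros H. apply is_derive_Reals. intros eps He.
  assert (Hd : 0 < Rmin 1 (eps / (Rabs C + 1))).
  { apply Rmin_case; [lra |]. apply Rdiv_lt_0_compat; auto.
    pose proof (Rabs_pos C); lra. }
  exists (mkposreal _ Hd). intros h Hh Hlt. simpl in Hlt.
  assert (H1 : Rabs h <= 1) by (pose proof (Rmin_l 1 (eps / (Rabs C + 1))); lra).
  assert (H2 : Rabs h < eps / (Rabs C + 1))
    by (pose proof (Rmin_r 1 (eps / (Rabs C + 1))); lra).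
  specialize (H (t + h)). replace (t + h - t) with h in H by ring.
  specialize (H H1).
  replace ((f (t + h) - f t) / h - l)
    with ((f (t + h) - f t - l * h) * / h) by (field; auto).
  rewrite Rabs_mult, Rabs_inv.
  assert (Hp : 0 < Rabs h) by now apply Rabs_pos_lt.
  apply (Rmult_lt_reg_r (Rabs h)); auto.
  rewrite Rmult_assoc, Rinv_l, Rmult_1_r by lra.
  rewrite <- pow2_abs in H.
  pose proof (Rabs_pos C). pose proof (Rle_abs C).
  apply (Rmult_lt_compat_r (Rabs C + 1)) in H2; [| lra].
  replace (eps / (Rabs C + 1) * (Rabs C + 1)) with eps in H2 by (field; lra).
  apply Rle_lt_trans with (C * Rabs h ^ 2); auto.
  apply Rle_lt_trans with (Rabs h * (Rabs h * (Rabs C + 1))); [nra |].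
  rewrite Rmult_comm. apply Rmult_lt_compat_r; auto.
Qed.

Lemma Rabs_le_of_near (t t' a : R) : Rabs (t' - t) <= a -> Rabs t' <= Rabs t + a.
Proof.
  intros H. replace t' with (t + (t' - t)) by ring.
  eapply Rle_trans; [apply Rabs_triang |]. lra.
Qed.

Lemma constant_of_derive0 (f : R -> R) (a b : R) :
  (forall x, is_derive f x 0) -> f a = f b.
Proof.
  intros H. destruct (mean_value f (fun _ => 0) b a H) as [c [_ E]]. lra.
Qed.

(** The solution V of the linearised equation V' = r'(X) V, V(0) = 1, along the orbit
    X of t; it turns out to be the derivative of the flow with respect to t. *)
Definition flow_factor (r r1 : R -> R) (t s : R) : R :=
  exp (RInt (fun z => r1 (flow r t z)) 0 s).

(** Gronwall's inequality in the initial point, and the bound of r in time. *)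
Lemma flow_C0 (r : R -> R) (M : R) :
  smooth1 r -> (forall y, Rabs (r y) <= M) -> Ck 0 (flow r).
Proof.
  intros Hr HM. split; auto. intros t s.
  pose proof (smooth1_continuity r Hr) as Hc.
  pose proof (smooth1_lipschitz r Hr) as Hl.
  destruct (gronwall r M (Rabs t + 1) (Rabs s + 1) HM Hl) as [L [HL0 HL]].
  { pose proof (Rabs_pos s); lra. }
  intros eps.
  assert (HM0 : 0 <= M) by (apply Rle_trans with (2 := HM 0); apply Rabs_pos).
  assert (Hd : 0 < Rmin 1 (eps / (L + M))).
  { apply Rmin_case; [lra |]. apply Rdiv_lt_0_compat; [apply cond_pos | lra]. }
  exists (mkposreal _ Hd). intros t' s' Ht Hs. simpl in Ht, Hs.
  pose proof (Rmin_l 1 (eps / (L + M))) as M1.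
  pose proof (Rmin_r 1 (eps / (L + M))) as M2.
  destruct (flow_solution r M t Hc HM Hl) as [S1 E1].
  destruct (flow_solution r M t' Hc HM Hl) as [S2 E2].
  replace (flow r t' s' - flow r t s) with
    ((flow r t' s' - flow r t s') + (flow r t s' - flow r t s)) by ring.
  eapply Rle_lt_trans; [apply Rabs_triang |].
  assert (B1 : Rabs (flow r t' s' - flow r t s') <= L * Rabs (t' - t)).
  { pose proof (HL _ _ S2 S1) as B. rewrite E1, E2 in B. apply B.
    - apply Rabs_le_of_near. lra.
    - lra.
    - apply Rabs_le_of_near. lra. }
  assert (B2 : Rabs (flow r t s' - flow r t s) <= M * Rabs (s' - s))
    by (now apply flow_lipschitz_time).
  set (d := Rmin 1 (eps / (L + M))) in *.
  assert ((L + M) * d <= eps).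
  { apply Rmult_le_reg_r with (/ (L + M)).
    - apply Rinv_0_lt_compat; lra.
    - replace ((L + M) * d * / (L + M)) with d by (field; lra). exact M2. }
  nra.
Qed.

Lemma flow_factor_derive (r r1 : R -> R) (M t s : R) :
  smooth1 r -> smooth1 r1 -> (forall y, Rabs (r y) <= M) ->
  is_derive (flow_factor r r1 t) s
    (r1 (flow r t s) * flow_factor r r1 t s).
Proof.
  intros Hr Hr1 HM. unfold flow_factor.
  apply (is_derive_comp exp (fun s => RInt (fun z => r1 (flow r t z)) 0 s)).
  - apply is_derive_exp.
  - apply (is_derive_RInt_R (fun z => r1 (flow r t z))). intros z.
    apply continuous_comp_R; [now apply smooth1_continuity |].
    apply (continuous_of_lipschitz _ M). intros. apply flow_lipschitz_time; auto.
    + now apply smooth1_continuity.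
    + now apply smooth1_lipschitz.
Qed.

Lemma locally_quadratic_remainder (r r1 : R -> R) : (forall x, is_derive r x (r1 x)) ->
  locally_lipschitz r1 ->
  forall A, exists K, 0 < K /\ forall x y, Rabs x <= A -> Rabs y <= A ->
    Rabs (r y - r x - r1 x * (y - x)) <= K * (y - x) ^ 2.
Proof.
  intros Hd Hl A. destruct (Hl A) as [K [HK H]]. exists K. split; auto.
  intros x y Hx Hy. destruct (mean_value r r1 x y Hd) as [c [Hc ->]].
  replace (r1 c * (y - x) - r1 x * (y - x)) with ((r1 c - r1 x) * (y - x))
    by ring.
  rewrite Rabs_mult, <- (pow2_abs (y - x)).
  assert (Hcx : Rabs (c - x) <= Rabs (y - x)).
  { revert Hc. unfold Rmin, Rmax. destruct (Rle_dec x y); intros.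
    - rewrite !Rabs_right; lra.
    - rewrite !Rabs_left1; lra. }
  pose proof (H c x (between_abs x y c A Hc Hx Hy) Hx).
  replace (K * Rabs (y - x) ^ 2) with (K * Rabs (y - x) * Rabs (y - x)) by ring.
  apply Rmult_le_compat_r; [apply Rabs_pos |].
  apply Rle_trans with (K * Rabs (c - x)); auto.
  apply Rmult_le_compat_l; lra.
Qed.

(** Let D be the difference of the solutions issued from t' and t, and V the
    linearised flow. The derivative of D/V is (r(X + D) - r(X) - r'(X) D) / V, where X is the
    orbit of t; it is O(D^2), that is O((t' - t)^2) by Gronwall's inequality. As D/V = t' - t at
    time 0, D = V (t' - t) + O((t' - t)^2). *)
Lemma flow_derive_initial (r r1 : R -> R) (M t s : R) :
  smooth1 r -> smooth1 r1 -> (forall x, is_derive r x (r1 x)) ->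
  (forall y, Rabs (r y) <= M) ->
  is_derive (fun t => flow r t s) t (flow_factor r r1 t s).
Proof.
  intros Hr Hr1 Hd HM.
  pose proof (smooth1_continuity r Hr) as Hc.
  pose proof (smooth1_lipschitz r Hr) as Hl.
  assert (HM0 : 0 <= M) by (apply Rle_trans with (2 := HM 0); apply Rabs_pos).
  destruct (gronwall r M (Rabs t + 1) (Rabs s) HM Hl (Rabs_pos s))
    as [L [HL0 HL]].
  destruct (locally_quadratic_remainder r r1 Hd (smooth1_lipschitz r1 Hr1)
    (Rabs t + 1 + M * Rabs s)) as [K [HK HT]].
  set (V := flow_factor r r1 t).
  assert (HV : forall z, is_derive V z (r1 (flow r t z) * V z))
    by (intros z; now apply (flow_factor_derive r r1 M)).
  assert (HVpos : forall z, 0 < V z) by (intros z; apply exp_pos).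
  assert (V0 : V 0 = 1).
  { unfold V, flow_factor.
    rewrite (RInt_point (V := R_CompleteNormedModule)). apply exp_0. }
  destruct (continuous_bounded (fun z => / V z) (Rabs s)) as [B [HB0 HB]].
  { intros z. apply continuity_pt_inv.
    - apply (is_derive_continuity_pt _ _ _ (HV z)).
    - specialize (HVpos z); lra. }
  destruct (flow_solution r M t Hc HM Hl) as [S1 E1].
  apply (is_derive_quadratic _ _ _ (V s * (K * L ^ 2 * B * Rabs s))).
  intros t' Ht.
  destruct (flow_solution r M t' Hc HM Hl) as [S2 E2].
  set (D := fun z => flow r t' z - flow r t z).
  assert (HD : forall z, Rabs z <= Rabs s -> Rabs (D z) <= L * Rabs (t' - t)).
  { intros z Hz. pose proof (HL _ _ S2 S1) as H. rewrite E1, E2 in H.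
    apply H; auto.
    - now apply Rabs_le_of_near.
    - lra. }
  assert (Hin : forall u z, Rabs u <= Rabs t + 1 -> Rabs z <= Rabs s ->
    Rabs (flow r u z) <= Rabs t + 1 + M * Rabs s).
  { intros u z Hu Hz. destruct (flow_solution r M u Hc HM Hl) as [Su Eu].
    pose proof (solution_lipschitz r M _ z HM Su) as H. rewrite Eu in H.
    pose proof (Rabs_le_of_near _ _ _ H).
    pose proof (Rmult_le_compat_l M _ _ HM0 Hz). lra. }
  assert (HW : forall z, is_derive (fun z => D z / V z) z
    ((r (flow r t' z) - r (flow r t z) - r1 (flow r t z) * D z) / V z)).
  { intros z. eapply is_derive_eq.
    - apply is_derive_div.
      + apply (is_derive_minus (K := R_AbsRing) (V := R_NormedModule)
          (flow r t') (flow r t)); [apply S2 | apply S1].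
      + apply HV.
      + specialize (HVpos z); lra.
    - unfold minus, plus, opp; simpl. field. specialize (HVpos z); lra. }
  destruct (mean_value _ _ 0 s HW) as [c [Hcs Ec]].
  assert (Hc' : Rabs c <= Rabs s).
  { apply (between_abs 0 s); auto; try lra. rewrite Rabs_R0. apply Rabs_pos. }
  assert (D0 : D 0 / V 0 = t' - t) by (unfold D; rewrite E1, E2, V0; field).
  cbv beta in Ec. rewrite D0, Rminus_0_r in Ec.
  replace (flow r t' s - flow r t s - V s * (t' - t))
    with (V s * (D s / V s - (t' - t))).
  2:{ unfold D. field. specialize (HVpos s); lra. }
  rewrite Ec, !Rabs_mult, (Rabs_right (V s)) by (specialize (HVpos s); lra).
  rewrite Rmult_assoc. apply Rmult_le_compat_l; [specialize (HVpos s); lra |].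
  unfold Rdiv. rewrite Rabs_mult.
  assert (A1 := HT (flow r t c) (flow r t' c)
    (Hin t c ltac:(lra) Hc') (Hin t' c (Rabs_le_of_near _ _ _ Ht) Hc')).
  change (flow r t' c - flow r t c) with (D c) in A1.
  assert (A2 : D c ^ 2 <= L ^ 2 * (t' - t) ^ 2).
  { rewrite <- (pow2_abs (D c)), <- (pow2_abs (t' - t)), <- Rpow_mult_distr.
    apply pow_incr. split; [apply Rabs_pos | now apply HD]. }
  assert (A3 := HB c Hc').
  assert (A4 : Rabs (r (flow r t' c) - r (flow r t c) - r1 (flow r t c) * D c)
    <= K * (L ^ 2 * (t' - t) ^ 2)).
  { eapply Rle_trans; [apply A1 |]. apply Rmult_le_compat_l; lra. }
  replace (K * L ^ 2 * B * Rabs s * (t' - t) ^ 2)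
    with (K * (L ^ 2 * (t' - t) ^ 2) * B * Rabs s) by ring.
  apply Rmult_le_compat_r; [apply Rabs_pos |].
  apply Rmult_le_compat; auto; apply Rabs_pos.
Qed.

(** Bootstrap: both partial derivatives of the flow, r(flow) and
    exp of the integral of r'(flow), are as smooth as the flow itself. *)
Lemma flow_smooth (r : R -> R) (M : R) :
  smooth1 r -> (forall y, Rabs (r y) <= M) -> smooth (flow r).
Proof.
  intros Hr HM. destruct (smooth1_derive r Hr) as [r1 [Hr1 Hd]].
  intros n. induction n as [|n IH].
  - now apply (flow_C0 r M).
  - apply (Ck_S n _ (flow_factor r r1) (fun t s => r (flow r t s))).
    + intros t s. now apply (flow_derive_initial r r1 M).
    + intros t s. apply (flow_solution r M t); auto.
      * now apply smooth1_continuity.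
      * now apply smooth1_lipschitz.
    + unfold flow_factor. apply Ck_exp.
      apply (Ck_RInt n (fun t z => r1 (flow r t z))).
      apply (Ck_comp n (fun x _ => r1 x) (flow r) (fun _ _ => 0)); auto.
      apply Ck_const.
    + apply (Ck_comp n (fun x _ => r x) (flow r) (fun _ _ => 0)); auto.
      apply Ck_const.
Qed.

(** The field is invariant under its own flow: along an orbit, r and the linearised
    flow solve the same linear equation. *)
Lemma flow_invariant (r r1 : R -> R) (M t s : R) :
  smooth1 r -> smooth1 r1 -> (forall x, is_derive r x (r1 x)) ->
  (forall y, Rabs (r y) <= M) ->
  r t * flow_factor r r1 t s = r (flow r t s).
Proof.
  intros Hr Hr1 Hd HM.
  destruct (flow_solution r M t (smooth1_continuity r Hr) HM
    (smooth1_lipschitz r Hr)) as [S1 E1].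
  assert (HV : forall z, 0 < flow_factor r r1 t z) by (intros; apply exp_pos).
  assert (H : forall z,
    is_derive (fun z => r (flow r t z) / flow_factor r r1 t z) z 0).
  { intros z. eapply is_derive_eq.
    - apply is_derive_div.
      + apply (is_derive_comp r (flow r t)); [apply Hd | apply S1].
      + now apply (flow_factor_derive r r1 M).
      + specialize (HV z); lra.
    - unfold scal; simpl. unfold mult; simpl. field. specialize (HV z); lra. }
  pose proof (constant_of_derive0 _ 0 s H) as E. cbv beta in E.
  assert (V0 : flow_factor r r1 t 0 = 1).
  { unfold flow_factor.
    rewrite (RInt_point (V := R_CompleteNormedModule)). apply exp_0. }
  rewrite E1, V0 in E. replace (r t) with (r t / 1) by field. rewrite E.
  field. specialize (HV s); lra.
Qed.

(** By uniqueness, following the orbit backwards for a time s and then forwards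
    for a time s leads back to the start. *)
Lemma flow_inverse (r : R -> R) (M t s : R) :
  smooth1 r -> (forall y, Rabs (r y) <= M) ->
  flow r (flow r t (- s)) s = t.
Proof.
  intros Hr HM.
  pose proof (smooth1_continuity r Hr) as Hc.
  pose proof (smooth1_lipschitz r Hr) as Hl.
  destruct (flow_solution r M t Hc HM Hl) as [S1 E1].
  destruct (flow_solution r M (flow r t (- s)) Hc HM Hl) as [S2 E2].
  rewrite (solution_unique r M _ (fun z => flow r t (z + - s)) HM Hl S2).
  - replace (s + - s) with 0 by ring. exact E1.
  - intros z. eapply is_derive_eq.
    + apply (is_derive_comp (flow r t) (fun z => z + - s)).
      * apply S1.
      * apply (is_derive_plus (K := R_AbsRing) (V := R_NormedModule)
          (fun z => z) (fun _ => - s)).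
        -- apply is_derive_id.
        -- apply is_derive_const.
    + unfold scal, plus, one, zero; simpl. unfold mult; simpl. ring.
  - rewrite E2. f_equal. ring.
Qed.

(** * The transport equation *)

(** In the coordinates (tau, x) with t = flow(tau, x), the operator
    r d/dt + d/dx is d/dx, inverted by an integral from 0: this is U. As the flow is global,
    tau = flow(t, -x) is defined for all (t, x), and v(t, x) = U(flow(t, -x), x). *)
Lemma transport_solvable (r : R -> R) (M : R) (g : R -> R -> R) :
  smooth1 r -> (forall y, Rabs (r y) <= M) -> smooth g ->
  exists v v1 v2, smooth v /\
    (forall t x, is_derive (fun z => v z x) t (v1 t x)) /\
    (forall t x, is_derive (v t) x (v2 t x)) /\
    (forall t x, continuity_2d_pt v1 t x) /\
    (forall t x, r t * v1 t x + v2 t x = g t x).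
Proof.
  intros Hr HM Hg. destruct (smooth1_derive r Hr) as [r1 [Hr1 Hd]].
  pose proof (flow_smooth r M Hr HM) as HF.
  pose proof (smooth1_continuity r Hr) as Hc.
  pose proof (smooth1_lipschitz r Hr) as Hl.
  set (k := fun t s => g (flow r t s) s).
  assert (Hk : smooth k).
  { intros n. apply (Ck_comp n g (flow r) (fun _ s => s)); auto. apply Ck_snd. }
  set (U := fun t x => RInt (k t) 0 x).
  assert (HU : smooth U) by (intros n; now apply Ck_RInt).
  destruct (smooth_partial_fst U HU) as [U1 [HU1 dU1]].
  set (T := fun t x => flow r t (- x)).
  assert (HT : smooth T).
  { intros n. apply (Ck_comp n (flow r) (fun t _ => t) (fun _ x => - x)); auto.
    - apply Ck_fst.
    - apply Ck_opp, Ck_snd. }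
  assert (dU2 : forall t x, is_derive (U t) x (k t x)).
  { intros t x. apply is_derive_RInt_R. intros s.
    apply continuity_2d_slice. apply (Ck_continuity 0), Hk. }
  assert (Hv : smooth (fun t x => U (T t x) x)).
  { intros n. apply (Ck_comp n U T (fun _ x => x)); auto. apply Ck_snd. }
  destruct (smooth_partial_fst _ Hv) as [v1 [Hv1 dv1]].
  exists (fun t x => U (T t x) x), v1,
    (fun t x => U1 (T t x) x * - r (T t x) + k (T t x) x * 1).
  split; [exact Hv |]. split; [exact dv1 |]. split; [| split].
  - intros t x. apply (is_derive_comp_2d U U1 k (T t) (fun x => x)); auto.
    + apply (Ck_continuity 0), HU1.
    + eapply is_derive_eq.
      * apply (is_derive_comp (flow r t) (fun x => - x)).
        -- apply (flow_solution r M t); auto.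
        -- apply (is_derive_opp (K := R_AbsRing) (V := R_NormedModule)
             (fun x => x)). apply is_derive_id.
      * unfold T, scal, opp, one; simpl. unfold mult; simpl. ring.
    + apply (is_derive_id (K := R_AbsRing)).
  - intros t x. apply (Ck_continuity 0), Hv1.
  - intros t x.
    assert (E : v1 t x
      = U1 (T t x) x * flow_factor r r1 t (- x) + k (T t x) x * 0).
    { rewrite <- (is_derive_unique _ _ _ (dv1 t x)). apply is_derive_unique.
      apply (is_derive_comp_2d U U1 k (fun t => T t x) (fun _ => x)); auto.
      - apply (Ck_continuity 0), HU1.
      - now apply (flow_derive_initial r r1 M).
      - apply (is_derive_const (K := R_AbsRing) (V := R_NormedModule)). }
    rewrite E.
    assert (Ek : k (T t x) x = g t x).
    { unfold k, T. now rewrite (flow_inverse r M). }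
    pose proof (flow_invariant r r1 M t (- x) Hr Hr1 Hd HM) as Ei.
    fold (T t x) in Ei. rewrite Ek.
    replace (r t * (U1 (T t x) x * flow_factor r r1 t (- x) + g t x * 0))
      with (U1 (T t x) x * (r t * flow_factor r r1 t (- x))) by ring.
    rewrite Ei. ring.
Qed.

(** * Surjectivity when q has one sign on the zeros of p *)

(** Induction on the Horner form, which spares any handling of degrees. *)
Lemma polynomial_horner_ind (P : (R -> R) -> Prop) :
  (forall a, P (fun _ => a)) ->
  (forall a p, P p -> P (fun t => a + t * p t)) ->
  forall p, is_polynomial p -> P p.
Proof.
  intros H0 HS p [a [d Hp]].
  replace p with (fun t => sum_f_R0 (fun k => a k * t ^ k) d)
    by (extensionality t; auto).
  clear p Hp. revert a. induction d as [|d IH]; intros a.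
  - replace (fun t => sum_f_R0 (fun k => a k * t ^ k) 0) with (fun _ : R => a O).
    + apply H0.
    + extensionality t. simpl. ring.
  - replace (fun t => sum_f_R0 (fun k => a k * t ^ k) (S d))
      with (fun t => a O + t * sum_f_R0 (fun k => a (S k) * t ^ k) d).
    + apply (HS (a O) (fun t => sum_f_R0 (fun k => a (S k) * t ^ k) d)), IH.
    + extensionality t. rewrite (decomp_sum _ (S d)) by lia.
      simpl pred. rewrite scal_sum. simpl pow at 2. rewrite Rmult_1_r.
      f_equal. apply sum_eq. intros i _. simpl. ring.
Qed.

Lemma polynomial_smooth p : is_polynomial p -> smooth1 p.
Proof.
  apply polynomial_horner_ind.
  - intros a n. apply Ck_const.
  - intros a q Hq n.
    apply (Ck_plus n (fun _ _ => a) (fun t _ => t * q t)).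
    + apply Ck_const.
    + apply (Ck_mult n (fun t _ => t) (fun t _ => q t)); auto. apply Ck_fst.
Qed.

(** If |p| is bounded below by d > 0 far away, then |t p(t)| tends
    to infinity and absorbs the added constant; otherwise p is the zero function and
    a + t p(t) is constant. *)
Lemma polynomial_lower_bound_at_infinity p : is_polynomial p -> (exists s, p s <> 0) ->
  exists A d, 0 < d /\ forall t, A <= Rabs t -> d <= Rabs (p t).
Proof.
  intros Hp [s Hs].
  assert (H : (forall t, p t = 0) \/
    exists A d, 0 < d /\ forall t, A <= Rabs t -> d <= Rabs (p t)).
  { clear s Hs. revert p Hp. apply polynomial_horner_ind.
    - intros a. destruct (Req_dec a 0) as [Ha | Ha]; [now left | right].
      exists 0, (Rabs a). split; [now apply Rabs_pos_lt |]. intros; lra.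
    - intros a p [H | [A [d [Hd H]]]].
      + destruct (Req_dec a 0) as [Ha | Ha].
        * left. intros t. rewrite H, Ha. ring.
        * right. exists 0, (Rabs a). split; [now apply Rabs_pos_lt |].
          intros t _. rewrite H, Rmult_0_r, Rplus_0_r. lra.
      + right. exists (Rmax A ((Rabs a + 1) / d)), 1. split; [lra |].
        intros t Ht.
        pose proof (Rmax_l A ((Rabs a + 1) / d)).
        pose proof (Rmax_r A ((Rabs a + 1) / d)).
        specialize (H t ltac:(lra)).
        assert (H' : Rabs a + 1 <= Rabs t * d).
        { replace (Rabs a + 1) with ((Rabs a + 1) / d * d) by (field; lra).
          apply Rmult_le_compat_r; lra. }
        assert (Rabs a + 1 <= Rabs (t * p t)).
        { rewrite Rabs_mult. apply Rle_trans with (1 := H').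
          apply Rmult_le_compat_l; auto. apply Rabs_pos. }
        pose proof (Rabs_triang_inv (t * p t) (- a)) as T.
        rewrite Rabs_Ropp in T.
        replace (a + t * p t) with (t * p t - - a) by ring. lra. }
  destruct H as [H | H]; auto. now rewrite H in Hs.
Qed.

(** The maximum of q and p^2 is positive everywhere, hence bounded below on
    compact sets; near infinity p^2 is bounded below. *)
Lemma uniform_lower_bound (p q : R -> R) :
  is_polynomial p -> is_polynomial q -> (exists s, p s <> 0) ->
  (forall s, p s = 0 -> 0 < q s) ->
  exists d, 0 < d /\ forall t, d <= q t \/ d <= p t ^ 2.
Proof.
  intros Hp Hq Hne Hpos.
  destruct (polynomial_lower_bound_at_infinity p Hp Hne) as [A [d [Hd HA]]].
  set (G := fun t => (q t + p t ^ 2 + Rabs (q t - p t ^ 2)) / 2).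
  assert (HG : forall t e, e <= G t -> e <= q t \/ e <= p t ^ 2).
  { intros t e. unfold G, Rabs. destruct (Rcase_abs (q t - p t ^ 2)); lra. }
  assert (GP : forall t, 0 < G t).
  { intros t. unfold G. destruct (Req_dec (p t) 0) as [E | E].
    - pose proof (Hpos t E). rewrite E. unfold Rabs.
      destruct (Rcase_abs (q t - 0 ^ 2)); lra.
    - assert (0 < p t ^ 2) by (apply pow2_gt_0; auto).
      unfold Rabs. destruct (Rcase_abs (q t - p t ^ 2)); lra. }
  assert (Gc : forall t, continuity_pt G t).
  { intros t. pose proof (smooth1_continuity _ (polynomial_smooth p Hp)) as Cp.
    pose proof (smooth1_continuity _ (polynomial_smooth q Hq)) as Cq.
    assert (Cp2 : continuity_pt (fun t => p t ^ 2) t).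
    { apply (continuity_pt_ext (fun t => p t * p t)).
      - intros; ring.
      - now apply continuity_pt_mult. }
    apply (continuity_pt_mult (fun t => q t + p t ^ 2 + Rabs (q t - p t ^ 2))
      (fun _ => / 2)).
    - apply continuity_pt_plus.
      + now apply continuity_pt_plus.
      + apply (continuity_pt_comp (fun t => q t - p t ^ 2) Rabs).
        * now apply continuity_pt_minus.
        * apply Rcontinuity_abs.
    - apply continuity_pt_const. now intros x y. }
  assert (HB : 0 <= Rabs A) by apply Rabs_pos.
  destruct (continuity_ab_min G (- Rabs A) (Rabs A)) as [m [Hm _]].
  - lra.
  - auto.
  - exists (Rmin (G m) (d ^ 2)). split.
    + apply Rmin_case; auto. now apply pow_lt.
    + intros t. destruct (Rle_dec A (Rabs t)) as [H | H].
      * right. apply Rle_trans with (d ^ 2); [apply Rmin_r |].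
        rewrite <- (pow2_abs (p t)). apply pow_incr. split; [lra | auto].
      * apply HG. apply Rle_trans with (G m); [apply Rmin_l |]. apply Hm.
        pose proof (Rle_abs A). apply Rabs_le_between. lra.
Qed.

Lemma smooth_of_snd c : smooth1 c -> smooth (fun _ x => c x).
Proof.
  intros H. apply (smooth1_after_smooth c (fun _ x => x)); auto.
  intros n. apply Ck_snd.
Qed.

Lemma smooth1_prim c : smooth1 c -> smooth1 (fun t => RInt c 0 t).
Proof.
  intros H n.
  apply (Ck_comp n (fun t x => RInt c 0 x) (fun _ _ => 0) (fun t _ => t)).
  - apply (Ck_RInt n (fun _ s => c s)). now apply smooth_of_snd.
  - apply Ck_const.
  - apply Ck_fst.
Qed.

(** In the coordinates (t, x - h(t)) with h' = - c p, the field becomes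
    p d/dt + Q d/dx with Q = q + c p^2. For c = (2 + p^2 + q^2)/d, with d the uniform lower bound
    of max(q, p^2), one gets Q > 0 and |p| <= Q everywhere. Division by Q then leaves the
    transport equation of the bounded field r = p/Q. *)
Lemma surjective_of_pos (p q : R -> R) :
  is_polynomial p -> is_polynomial q -> (exists s, p s <> 0) ->
  (forall s, p s = 0 -> 0 < q s) ->
  surjective_C_infty (vector_field p q).
Proof.
  intros Hp Hq Hne Hpos f Hf. apply smooth_C_infty in Hf.
  destruct (uniform_lower_bound p q Hp Hq Hne Hpos) as [d [Hd Halt]].
  pose proof (polynomial_smooth p Hp) as Sp.
  pose proof (polynomial_smooth q Hq) as Sq.
  set (c := fun t => (2 + p t * p t + q t * q t) * / d).
  assert (Sc : smooth1 c).
  { intros n.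
    apply (Ck_mult n (fun t _ => 2 + p t * p t + q t * q t) (fun _ _ => / d)).
    - apply (Ck_plus n (fun t _ => 2 + p t * p t) (fun t _ => q t * q t)).
      + apply (Ck_plus n (fun t _ => 2) (fun t _ => p t * p t)).
        * apply Ck_const.
        * apply (Ck_mult n (fun t _ => p t) (fun t _ => p t)); auto.
      + apply (Ck_mult n (fun t _ => q t) (fun t _ => q t)); auto.
    - apply Ck_const. }
  set (cp := fun t => c t * p t).
  assert (Scp : smooth1 cp)
    by (intros n; apply (Ck_mult n (fun t _ => c t) (fun t _ => p t)); auto).
  set (Q := fun t => q t + cp t * p t).
  assert (SQ : smooth1 Q).
  { intros n. apply (Ck_plus n (fun t _ => q t) (fun t _ => cp t * p t)); auto.
    apply (Ck_mult n (fun t _ => cp t) (fun t _ => p t)); auto. }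
  assert (HQ : forall t, 0 < Q t /\ Rabs (p t) <= Q t).
  { intros t.
    assert (Hi : 0 < / d) by now apply Rinv_0_lt_compat.
    assert (H2 : 0 <= p t ^ 2) by apply pow2_ge_0.
    assert (H3 : 0 <= q t ^ 2) by apply pow2_ge_0.
    assert (H4 : 0 <= (q t + 1) ^ 2) by apply pow2_ge_0.
    assert (H5 : 0 <= / d * p t ^ 2) by nra.
    assert (EQ : Q t = q t + (2 + p t ^ 2 + q t ^ 2) * (/ d * p t ^ 2))
      by (unfold Q, cp, c; ring).
    destruct (Halt t) as [H | H].
    - (* arithmetic-geometric mean inequality for d and p^2/d *)
      assert (H6 : 2 * Rabs (p t) <= d + / d * p t ^ 2).
      { apply Rmult_le_reg_l with d; auto.
        replace (d * (d + / d * p t ^ 2)) with (d ^ 2 + p t ^ 2)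
          by (field; lra).
        rewrite <- (pow2_abs (p t)).
        pose proof (pow2_ge_0 (Rabs (p t) - d)). nra. }
      assert (H7 : d + / d * p t ^ 2 <= Q t) by (rewrite EQ; nra).
      pose proof (Rabs_pos (p t)). split; lra.
    - assert (H6 : 1 <= / d * p t ^ 2).
      { replace 1 with (/ d * d) by (field; lra).
        apply Rmult_le_compat_l; lra. }
      assert (H7 : 1 + p t ^ 2 <= Q t) by (rewrite EQ; nra).
      rewrite <- pow2_abs in H7.
      pose proof (pow2_ge_0 (Rabs (p t) - 1)). pose proof (Rabs_pos (p t)).
      split; nra. }
  assert (HQ0 : forall t, Q t <> 0) by (intros t; destruct (HQ t); lra).
  set (r := fun t => p t * / Q t).
  assert (SiQ : smooth1 (fun t => / Q t))
    by (intros n; apply (Ck_inv n (fun t _ => Q t)); auto).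
  assert (Sr : smooth1 r).
  { intros n. apply (Ck_mult n (fun t _ => p t) (fun t _ => / Q t)); auto. }
  assert (Br : forall t, Rabs (r t) <= 1).
  { intros t. destruct (HQ t) as [Q1 Q2]. unfold r.
    rewrite Rabs_mult, Rabs_inv, (Rabs_right (Q t)) by lra.
    apply Rmult_le_reg_r with (Q t); auto.
    rewrite Rmult_assoc, Rinv_l, !Rmult_1_r, Rmult_1_l by lra. exact Q2. }
  (* the new coordinate is x - h(t), where h' = - c p *)
  set (h := fun t => - RInt cp 0 t).
  assert (Sh : smooth1 h).
  { intros n. apply (Ck_opp n (fun t _ => RInt cp 0 t)).
    now apply smooth1_prim. }
  assert (dh : forall t, is_derive h t (- cp t)).
  { intros t. apply (is_derive_opp (K := R_AbsRing) (V := R_NormedModule)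
      (fun t => RInt cp 0 t)).
    apply is_derive_RInt_R. intros s. apply continuity_pt_filterlim.
    now apply smooth1_continuity. }
  set (g := fun t x => f t (x + h t) * / Q t).
  assert (Sg : smooth g).
  { intros n. apply (Ck_mult n (fun t x => f t (x + h t)) (fun t _ => / Q t)).
    - apply (Ck_comp n f (fun t _ => t) (fun t x => x + h t)); auto.
      + apply Ck_fst.
      + apply (Ck_plus n (fun _ x => x) (fun t _ => h t)); auto. apply Ck_snd.
    - apply SiQ. }
  destruct (transport_solvable r 1 g Sr Br Sg)
    as [v [v1 [v2 [Sv [dv1 [dv2 [Cv1 Ev]]]]]]].
  exists (fun t x => v t (x - h t)). split.
  - apply smooth_C_infty. intros n.
    apply (Ck_comp n v (fun t _ => t) (fun t x => x - h t)); auto.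
    + apply Ck_fst.
    + apply (Ck_minus n (fun _ x => x) (fun t _ => h t)); auto. apply Ck_snd.
  - intros t x. unfold vector_field.
    assert (E1 : Derive (fun s => v s (x - h s)) t
      = v1 t (x - h t) * 1 + v2 t (x - h t) * cp t).
    { apply is_derive_unique.
      apply (is_derive_comp_2d v v1 v2 (fun t => t) (fun t => x - h t)); auto.
      - apply (is_derive_id (K := R_AbsRing)).
      - eapply is_derive_eq.
        + apply (is_derive_minus (K := R_AbsRing) (V := R_NormedModule)
            (fun _ => x) h); [apply is_derive_const | apply dh].
        + unfold minus, plus, opp, zero; simpl. ring. }
    assert (E2 : Derive (fun y => v t (y - h t)) x = v2 t (x - h t)).
    { apply is_derive_unique. eapply is_derive_eq.
      - apply (is_derive_comp (v t) (fun y => y - h t)).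
        + apply dv2.
        + apply (is_derive_minus (K := R_AbsRing) (V := R_NormedModule)
            (fun y => y) (fun _ => h t)).
          * apply is_derive_id.
          * apply is_derive_const.
      - unfold scal, minus, plus, opp, one, zero; simpl. unfold mult; simpl.
        ring. }
    rewrite E1, E2.
    assert (E := Ev t (x - h t)). unfold g, r in E.
    replace (x - h t + h t) with x in E by ring.
    replace (p t * (v1 t (x - h t) * 1 + v2 t (x - h t) * cp t)
      + q t * v2 t (x - h t))
      with (Q t * (p t * / Q t * v1 t (x - h t) + v2 t (x - h t))).
    + rewrite E. field. apply HQ0.
    + unfold Q. field. apply HQ0.
Qed.

Lemma surjective_opp (p q : R -> R) :
  surjective_C_infty (vector_field (fun t => - p t) (fun t => - q t)) ->
  surjective_C_infty (vector_field p q).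
Proof.
  intros H f Hf. destruct (H (fun t x => - f t x)) as [u [Hu E]].
  - apply smooth_C_infty. intros n. apply Ck_opp.
    now apply (proj1 (smooth_C_infty f)).
  - exists u. split; auto. intros t x. specialize (E t x).
    unfold vector_field in *. lra.
Qed.

Lemma polynomial_opp p : is_polynomial p -> is_polynomial (fun t => - p t).
Proof.
  intros [a [d Hp]]. exists (fun k => - a k), d. intros t. rewrite Hp.
  rewrite <- (Rmult_1_l (sum_f_R0 _ _)), Ropp_mult_distr_l, scal_sum.
  apply sum_eq. intros i _. ring.
Qed.

(** * Behaviour of the characteristic curves at the ends of a strip *)

Lemma nondecreasing_of_derive_on (f f' : R -> R) (a b : R) : a <= b ->
  (forall x, a <= x <= b -> is_derive f x (f' x)) ->
  (forall x, a <= x <= b -> 0 <= f' x) -> f a <= f b.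
Proof.
  intros Hab Hf Hn. destruct (MVT_gen f a b f') as [c [Hc E]].
  - rewrite Rmin_left, Rmax_right by lra. intros x Hx. apply Hf. lra.
  - rewrite Rmin_left, Rmax_right by lra. intros x Hx.
    apply (is_derive_continuity_pt _ _ (f' x)). now apply Hf.
  - rewrite Rmin_left, Rmax_right in Hc by lra. specialize (Hn c Hc). nra.
Qed.

(** Near a, p(t) <= L (t - a) and q >= q(a)/2, so that x' >= c/(t - a) for a constant
    c > 0, and x - c log(t - a) is nondecreasing. *)
Lemma log_divergence (p q x : R -> R) (a b : R) : a < b ->
  (forall t, a < t < b -> is_derive x t (q t / p t)) ->
  (forall t, a < t < b -> 0 < p t) ->
  p a = 0 -> ex_derive p a -> continuity_pt q a -> 0 < q a ->
  forall M, exists eta, 0 < eta /\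
    forall t, a < t < a + eta -> t < b -> x t < M.
Proof.
  intros Hab Hx Hp Ha [l Hl] Hq Hqa M.
  apply is_derive_Reals in Hl. destruct (Hl 1 Rlt_0_1) as [d1 Hd1].
  destruct (proj1 (continuity_pt_locally q a) Hq
    (mkposreal (q a / 2) ltac:(lra))) as [d2 Hd2].
  set (L := Rabs l + 1).
  assert (HL : 0 < L) by (unfold L; pose proof (Rabs_pos l); lra).
  set (c := q a / (2 * L)).
  assert (Hc : 0 < c) by (apply Rdiv_lt_0_compat; lra).
  set (w := Rmin (b - a) (Rmin d1 d2)).
  assert (Hw : 0 < w).
  { apply Rmin_case; [lra |]. apply Rmin_case; apply cond_pos. }
  assert (W1 : w <= b - a) by apply Rmin_l.
  assert (W2 : w <= d1)
    by (apply Rle_trans with (1 := Rmin_r _ _); apply Rmin_l).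
  assert (W3 : w <= d2)
    by (apply Rle_trans with (1 := Rmin_r _ _); apply Rmin_r).
  assert (Hlow : forall t, a < t < a + w -> c * / (t - a) <= q t / p t).
  { intros t Ht.
    assert (Hqt : q a / 2 <= q t).
    { assert (B : Rabs (q t - q a) < q a / 2).
      { apply (Hd2 t). change (Rabs (t - a) < d2). rewrite Rabs_right; lra. }
      apply Rabs_lt_between in B. lra. }
    assert (Hpt : p t <= L * (t - a)).
    { specialize (Hd1 (t - a) ltac:(lra)).
      rewrite Rabs_right in Hd1 by lra. specialize (Hd1 ltac:(lra)).
      replace (a + (t - a)) with t in Hd1 by ring. rewrite Ha in Hd1.
      apply Rabs_lt_between in Hd1. pose proof (Rle_abs l).
      replace (p t) with ((p t - 0) / (t - a) * (t - a)) by (field; lra).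
      apply Rmult_le_compat_r; unfold L; lra. }
    assert (Hp0 : 0 < p t) by (apply Hp; lra).
    apply Rle_trans with (q a / 2 * / (L * (t - a))).
    - right. unfold c. field. lra.
    - apply Rmult_le_compat; try lra.
      + left. apply Rinv_0_lt_compat. nra.
      + apply Rinv_le_contravar; lra. }
  set (m := a + w / 2).
  set (e := exp ((M - 1 - x m) / c + ln (m - a))).
  exists (Rmin (w / 2) e). split.
  { apply Rmin_case; [lra | apply exp_pos]. }
  intros t Ht Htb.
  pose proof (Rmin_l (w / 2) e). pose proof (Rmin_r (w / 2) e).
  assert (Hmono : x t - c * ln (t - a) <= x m - c * ln (m - a)).
  { apply (nondecreasing_of_derive_on (fun s => x s - c * ln (s - a))
      (fun s => q s / p s - c * / (s - a))).
    - unfold m; lra.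
    - intros s Hs. unfold m in Hs.
      apply (is_derive_minus (K := R_AbsRing) (V := R_NormedModule)
        x (fun s => c * ln (s - a))).
      + apply Hx. lra.
      + auto_derive; [lra |]. field. lra.
    - intros s Hs. unfold m in Hs. specialize (Hlow s ltac:(lra)). lra. }
  assert (Hln : ln (t - a) < (M - 1 - x m) / c + ln (m - a)).
  { rewrite <- (ln_exp (_ + _)). apply ln_increasing; [lra |]. fold e. lra. }
  apply (Rmult_lt_compat_l c) in Hln; auto.
  replace (c * ((M - 1 - x m) / c + ln (m - a)))
    with (M - 1 - x m + c * ln (m - a)) in Hln by (field; lra).
  lra.
Qed.

Lemma filterlim_right_m_infty (x : R -> R) (a b : R) : a < b ->
  (forall M, exists eta, 0 < eta /\
    forall t, a < t < a + eta -> t < b -> x t < M) ->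
  filterlim x (at_right a) (Rbar_locally m_infty).
Proof.
  intros Hab H P [M HM]. destruct (H M) as [eta [He Ht]].
  assert (Hd : 0 < Rmin eta (b - a)) by (apply Rmin_case; lra).
  exists (mkposreal _ Hd). intros t Hb Hat.
  change (Rabs (t - a) < Rmin eta (b - a)) in Hb.
  rewrite Rabs_right in Hb by lra.
  pose proof (Rmin_l eta (b - a)). pose proof (Rmin_r eta (b - a)).
  apply HM, Ht; lra.
Qed.

Lemma filterlim_right_p_infty (x : R -> R) (a b : R) : a < b ->
  (forall M, exists eta, 0 < eta /\
    forall t, a < t < a + eta -> t < b -> - x t < M) ->
  filterlim x (at_right a) (Rbar_locally p_infty).
Proof.
  intros Hab H P [M HM]. destruct (H (- M)) as [eta [He Ht]].
  assert (Hd : 0 < Rmin eta (b - a)) by (apply Rmin_case; lra).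
  exists (mkposreal _ Hd). intros t Hb Hat.
  change (Rabs (t - a) < Rmin eta (b - a)) in Hb.
  rewrite Rabs_right in Hb by lra.
  pose proof (Rmin_l eta (b - a)). pose proof (Rmin_r eta (b - a)).
  specialize (Ht t ltac:(lra) ltac:(lra)). apply HM. lra.
Qed.

Lemma filterlim_left_reflect (x : R -> R) (b : R) (l : Rbar) :
  filterlim (fun t => x (- t)) (at_right (- b)) (Rbar_locally l) ->
  filterlim x (at_left b) (Rbar_locally l).
Proof.
  intros H P HP. destruct (H P HP) as [d Hd]. exists d. intros t Ht Hlt.
  specialize (Hd (- t)). rewrite Ropp_involutive in Hd. apply Hd; [| lra].
  change (Rabs (- t - - b) < d). change (Rabs (t - b) < d) in Ht.
  rewrite <- Rabs_Ropp. replace (- (- t - - b)) with (t - b) by ring. exact Ht.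
Qed.

Lemma limit_left_end (p q x : R -> R) (a b : R) : a < b ->
  (forall t, a < t < b -> is_derive x t (q t / p t)) ->
  (forall t, a < t < b -> 0 < p t) ->
  p a = 0 -> ex_derive p a -> continuity_pt q a ->
  (0 < q a -> filterlim x (at_right a) (Rbar_locally m_infty)) /\
  (q a < 0 -> filterlim x (at_right a) (Rbar_locally p_infty)).
Proof.
  intros Hab Hx Hp Ha Dp Cq. split; intros Hq.
  - apply (filterlim_right_m_infty x a b Hab).
    now apply (log_divergence p q).
  - apply (filterlim_right_p_infty x a b Hab).
    apply (log_divergence p (fun t => - q t) (fun t => - x t)); auto.
    + intros t Ht. eapply is_derive_eq.
      * apply (is_derive_opp (K := R_AbsRing) (V := R_NormedModule)).
        now apply Hx.
      * unfold opp; simpl. field. specialize (Hp t Ht). lra.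
    + now apply continuity_pt_opp.
    + lra.
Qed.

(** The reflection t -> -t exchanges the two ends; it changes the sign of q/p
    and, with it, the roles of the two infinities. *)
Lemma limit_right_end (p q x : R -> R) (a b : R) : a < b ->
  (forall t, a < t < b -> is_derive x t (q t / p t)) ->
  (forall t, a < t < b -> 0 < p t) ->
  p b = 0 -> ex_derive p b -> continuity_pt q b ->
  (0 < q b -> filterlim x (at_left b) (Rbar_locally p_infty)) /\
  (q b < 0 -> filterlim x (at_left b) (Rbar_locally m_infty)).
Proof.
  intros Hab Hx Hp Hb Dp Cq.
  assert (dopp : forall t : R, is_derive (fun t => - t) t (-1)).
  { intros t. auto_derive; auto. }
  destruct (limit_left_end (fun t => p (- t)) (fun t => - q (- t))
    (fun t => x (- t)) (- b) (- a)) as [H1 H2].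
  - lra.
  - intros t Ht. eapply is_derive_eq.
    + apply (is_derive_comp x (fun t => - t)); [apply Hx; lra | apply dopp].
    + unfold scal; simpl. unfold mult; simpl. field.
      specialize (Hp (- t) ltac:(lra)). lra.
  - intros t Ht. apply Hp. lra.
  - now rewrite Ropp_involutive.
  - destruct Dp as [l Hl]. exists (-1 * l).
    apply (is_derive_comp p (fun t => - t)); [| apply dopp].
    now rewrite Ropp_involutive.
  - apply (continuity_pt_opp (fun t => q (- t))).
    apply (continuity_pt_comp (fun t => - t) q).
    + apply (is_derive_continuity_pt _ _ _ (dopp (- b))).
    + now rewrite Ropp_involutive.
  - rewrite Ropp_involutive in H1, H2.
    split; intros Hq; apply filterlim_left_reflect.
    + apply H2. lra.
    + apply H1. lra.
Qed.

Lemma not_both_infinities (F : (R -> Prop) -> Prop) (x : R -> R) : ProperFilter F ->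
  filterlim x F (Rbar_locally p_infty) ->
  filterlim x F (Rbar_locally m_infty) -> False.
Proof.
  intros HF H1 H2.
  assert (E1 : F (fun t => 0 < x t)) by (apply (H1 (fun y => 0 < y)); now exists 0).
  assert (E2 : F (fun t => x t < 0)) by (apply (H2 (fun y => y < 0)); now exists 0).
  destruct (filter_ex _ (filter_and _ _ E1 E2)) as [t Ht]. lra.
Qed.

Lemma characteristic_curve_exists (p q : R -> R) (a b tau y : R) :
  a < tau < b -> (forall t, continuity_pt p t) -> (forall t, continuity_pt q t) ->
  (forall t, a < t < b -> p t <> 0) ->
  exists x, characteristic_curve p q a b tau y x.
Proof.
  intros Ht Cp Cq Hp.
  set (f := fun t => q t / p t).
  assert (Cf : forall t, a < t < b -> continuous f t).
  { intros t Hab. apply continuity_pt_filterlim.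
    apply continuity_pt_div; auto. }
  exists (fun t => y + RInt f tau t). split.
  - intros t Hab. eapply is_derive_eq.
    + apply (is_derive_plus (K := R_AbsRing) (V := R_NormedModule)
        (fun _ => y) (fun t => RInt f tau t)); [apply is_derive_const |].
      apply (is_derive_RInt f (fun t => RInt f tau t) tau t); [| now apply Cf].
      assert (Hd : 0 < Rmin (t - a) (b - t)) by (apply Rmin_case; lra).
      exists (mkposreal _ Hd). intros s Hs.
      change (Rabs (s - t) < Rmin (t - a) (b - t)) in Hs.
      pose proof (Rmin_l (t - a) (b - t)). pose proof (Rmin_r (t - a) (b - t)).
      apply Rabs_lt_between in Hs.
      apply (RInt_correct (V := R_CompleteNormedModule)).
      apply (ex_RInt_continuous (V := R_CompleteNormedModule)).
      intros z Hz. apply Cf. revert Hz. unfold Rmin, Rmax.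
      destruct (Rle_dec tau s); lra.
    + apply plus_zero_l.
  - rewrite (RInt_point (V := R_CompleteNormedModule)). apply Rplus_0_r.
Qed.

(** As p > 0 in the strip, x tends to the infinity of sign - q(a) at a and to that
    of sign q(b) at b. The existence of a characteristic curve makes the left-hand side
    non-vacuous. *)
Lemma separatrix_iff_pos (p q : R -> R) (a b : R) : a < b ->
  smooth1 p -> smooth1 q -> p a = 0 -> p b = 0 ->
  (forall t, a < t < b -> 0 < p t) -> q a <> 0 -> q b <> 0 ->
  (separatrix p q a b <-> q a * q b < 0).
Proof.
  intros Hab Sp Sq Ha Hb Hp Qa Qb.
  pose proof (smooth1_continuity p Sp) as Cp.
  pose proof (smooth1_continuity q Sq) as Cq.
  assert (Dp : forall t, ex_derive p t).
  { intros t. destruct (smooth1_derive p Sp) as [p1 [_ D]]. now exists (p1 t). }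
  split.
  - intros Hsep. apply Rnot_le_lt. intros Hge.
    destruct (characteristic_curve_exists p q a b ((a + b) / 2) 0) as [x Hx];
      auto; try lra.
    { intros t Ht. specialize (Hp t Ht). lra. }
    specialize (Hsep ((a + b) / 2) 0 x ltac:(lra) Hx). destruct Hx as [Hx _].
    destruct (limit_left_end p q x a b) as [L1 L2]; auto.
    destruct (limit_right_end p q x a b) as [R1 R2]; auto.
    destruct (Rtotal_order (q a) 0) as [Ba | [Ba | Ba]]; [| lra |].
    + specialize (L2 Ba). assert (Bb : q b < 0)
        by (destruct (Rtotal_order (q b) 0) as [|[|]]; [auto | tauto | nra]).
      specialize (R2 Bb).
      destruct Hsep as [[_ S] | [S _]].
      * exact (not_both_infinities _ x (at_left_proper_filter b) S R2).
      * exact (not_both_infinities _ x (at_right_proper_filter a) L2 S).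
    + specialize (L1 Ba). assert (Bb : 0 < q b)
        by (destruct (Rtotal_order (q b) 0) as [|[|]]; [nra | tauto | auto]).
      specialize (R1 Bb).
      destruct Hsep as [[S _] | [_ S]].
      * exact (not_both_infinities _ x (at_right_proper_filter a) S L1).
      * exact (not_both_infinities _ x (at_left_proper_filter b) R1 S).
  - intros Hlt tau y x _ [Hx _].
    destruct (limit_left_end p q x a b) as [L1 L2]; auto.
    destruct (limit_right_end p q x a b) as [R1 R2]; auto.
    destruct (Rtotal_order (q a) 0) as [Ba | [Ba | Ba]]; [| lra |].
    + left. split; [auto |]. apply R1. nra.
    + right. split; [auto |]. apply R2. nra.
Qed.

Lemma separatrix_opp (p q : R -> R) (a b : R) :
  (forall t, a < t < b -> p t <> 0) ->
  separatrix (fun t => - p t) (fun t => - q t) a b -> separatrix p q a b.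
Proof.
  intros Hp H tau y x Ht [Hx Hy]. apply (H tau y x Ht). split; auto.
  intros t Hab. eapply is_derive_eq; [now apply Hx |].
  field. now apply Hp.
Qed.

Lemma intermediate_zero (f : R -> R) (a b : R) : a < b ->
  (forall t, a <= t <= b -> continuity_pt f t) -> f a * f b < 0 ->
  exists z, a < z < b /\ f z = 0.
Proof.
  intros Hab Cf H.
  assert (S : forall z, a <= z <= b -> f z = 0 -> a < z < b).
  { intros z [[H1 | <-] [H2 | H2]] E.
    - auto.
    - rewrite <- H2, E in H. lra.
    - rewrite E in H. lra.
    - rewrite E in H. lra. }
  destruct (Rlt_dec (f a) 0) as [Ha | Ha].
  - destruct (IVT_interv f a b Cf Hab) as [z [Hz E]]; try nra.
    exists z. split; auto.
  - assert (Ha' : 0 < f a).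
    { apply Rnot_lt_le in Ha. destruct Ha as [Ha | Ha]; auto.
      rewrite <- Ha in H. lra. }
    destruct (IVT_interv (fun t => - f t) a b) as [z [Hz E]]; try nra.
    + intros t Ht. apply continuity_pt_opp. now apply Cf.
    + exists z. split; [apply S |]; auto; lra.
Qed.

Lemma constant_sign (f : R -> R) (a b : R) : a < b ->
  (forall t, continuity_pt f t) -> (forall t, a < t < b -> f t <> 0) ->
  (forall t, a < t < b -> 0 < f t) \/ (forall t, a < t < b -> f t < 0).
Proof.
  intros Hab Cf Hne.
  assert (H : forall s t, a < s < b -> a < t < b -> 0 < f s * f t).
  { intros s t Hs Ht. pose proof (Hne s Hs). pose proof (Hne t Ht).
    apply Rnot_le_lt. intros Hle.
    assert (Hlt : f s * f t < 0).
    { destruct Hle as [Hle | Hle]; auto. apply Rmult_integral in Hle. tauto. }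
    destruct (Rtotal_order s t) as [L | [-> | L]].
    - destruct (intermediate_zero f s t L) as [z [Hz E]]; auto.
      apply (Hne z); auto; lra.
    - nra.
    - destruct (intermediate_zero f t s L) as [z [Hz E]]; auto; try nra.
      apply (Hne z); auto; lra. }
  set (m := (a + b) / 2). assert (Hm : a < m < b) by (unfold m; lra).
  destruct (Rtotal_order (f m) 0) as [L | [L | L]].
  - right. intros t Ht. specialize (H m t Hm Ht). nra.
  - now apply Hne in L.
  - left. intros t Ht. specialize (H m t Hm Ht). nra.
Qed.

Lemma separatrix_iff (p q : R -> R) (a b : R) : a < b ->
  smooth1 p -> smooth1 q -> p a = 0 -> p b = 0 ->
  (forall t, a < t < b -> p t <> 0) -> q a <> 0 -> q b <> 0 ->
  (separatrix p q a b <-> q a * q b < 0).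
Proof.
  intros Hab Sp Sq Ha Hb Hp Qa Qb.
  destruct (constant_sign p a b Hab (smooth1_continuity p Sp) Hp) as [H | H].
  - now apply separatrix_iff_pos.
  - assert (E : separatrix (fun t => - p t) (fun t => - q t) a b
      <-> - q a * - q b < 0).
    { apply (separatrix_iff_pos (fun t => - p t) (fun t => - q t)); auto;
        try lra.
      - intros n. now apply (Ck_opp n (fun t _ => p t)).
      - intros n. now apply (Ck_opp n (fun t _ => q t)).
      - intros t Ht. specialize (H t Ht). lra. }
    replace (- q a * - q b) with (q a * q b) in E by ring.
    rewrite <- E. split.
    + intros HS. apply separatrix_opp.
      * intros t Ht. specialize (H t Ht). lra.
      * replace (fun t => - - p t) with p
          by (extensionality t; ring).
        replace (fun t => - - q t) with q
          by (extensionality t; ring).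
        exact HS.
    + now apply separatrix_opp.
Qed.

Lemma nonneg_of_right (q : R -> R) (a c : R) : a < c -> continuity_pt q a ->
  (forall s, a < s < c -> 0 < q s) -> 0 <= q a.
Proof.
  intros Hac Cq H. apply Rnot_lt_le. intros Hn.
  destruct (proj1 (continuity_pt_locally q a) Cq
    (mkposreal (- q a) ltac:(lra))) as [d Hd].
  assert (Hm : 0 < Rmin d (c - a)) by (apply Rmin_case; [apply cond_pos | lra]).
  pose proof (Rmin_l d (c - a)). pose proof (Rmin_r d (c - a)).
  set (e := Rmin d (c - a) / 2) in *.
  assert (Hb : Rabs (q (a + e) - q a) < - q a).
  { apply (Hd (a + e)). change (Rabs (a + e - a) < d).
    replace (a + e - a) with e by ring. unfold e. rewrite Rabs_right; lra. }
  specialize (H (a + e) ltac:(unfold e; lra)).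
  apply Rabs_lt_between in Hb. lra.
Qed.

Lemma nonneg_of_left (q : R -> R) (b c : R) : c < b -> continuity_pt q b ->
  (forall s, c < s < b -> 0 < q s) -> 0 <= q b.
Proof.
  intros Hcb Cq H. rewrite <- (Ropp_involutive b).
  apply (nonneg_of_right (fun t => q (- t)) (- b) (- c)).
  - lra.
  - apply (continuity_pt_comp (fun t => - t) q).
    + apply continuity_pt_opp, derivable_continuous_pt, derivable_pt_id.
    + now rewrite Ropp_involutive.
  - intros s Hs. apply H. lra.
Qed.

(** An intermediate zero exists when q changes sign between a and b, and its
    uniqueness forces a constant sign on either side; conversely the signs inside pass to the
    ends, where q does not vanish. *)
Lemma opposite_signs_iff (q : R -> R) (a b : R) : a < b ->
  (forall t, continuity_pt q t) -> q a <> 0 -> q b <> 0 ->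
  (forall s s', a < s < b -> a < s' < b -> q s = 0 -> q s' = 0 -> s = s') ->
  (q a * q b < 0 <->
   exists theta, a < theta < b /\ q theta = 0 /\ opposite_signs q a theta b).
Proof.
  intros Hab Cq Qa Qb Hu.
  assert (Co : forall t, continuity_pt (fun t => - q t) t)
    by (intros t; now apply continuity_pt_opp).
  split.
  - intros Hlt. destruct (intermediate_zero q a b Hab (fun t _ => Cq t) Hlt)
      as [z [Hz E]].
    exists z. split; [auto | split; auto].
    assert (L : forall t, a < t < z -> 0 < q a * q t).
    { intros t Ht. assert (q t <> 0).
      { intros E'. assert (t = z) by (apply Hu; auto; lra). lra. }
      apply Rnot_le_lt. intros [Hle | Hle].
      - destruct (intermediate_zero q a t) as [y [Hy E']]; auto; try lra.
        assert (y = z) by (apply Hu; auto; lra). lra.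
      - apply Rmult_integral in Hle. tauto. }
    assert (R : forall t, z < t < b -> 0 < q t * q b).
    { intros t Ht. assert (q t <> 0).
      { intros E'. assert (t = z) by (apply Hu; auto; lra). lra. }
      apply Rnot_le_lt. intros [Hle | Hle].
      - destruct (intermediate_zero q t b) as [y [Hy E']]; auto; try lra.
        assert (y = z) by (apply Hu; auto; lra). lra.
      - apply Rmult_integral in Hle. tauto. }
    destruct (Rlt_dec (q a) 0) as [H | H].
    + right. split; intros s Hs.
      * specialize (L s Hs). nra.
      * specialize (R s Hs). nra.
    + left. split; intros s Hs.
      * specialize (L s Hs). nra.
      * specialize (R s Hs). nra.
  - intros [z [Hz [_ [[H1 H2] | [H1 H2]]]]].
    + assert (0 <= q a) by (apply (nonneg_of_right q a z); auto; lra).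
      assert (0 <= - q b).
      { apply (nonneg_of_left (fun t => - q t) b z); auto; try lra.
        intros s Hs. specialize (H2 s Hs). lra. }
      nra.
    + assert (0 <= q b) by (apply (nonneg_of_left q b z); auto; lra).
      assert (0 <= - q a).
      { apply (nonneg_of_right (fun t => - q t) a z); auto; try lra.
        intros s Hs. specialize (H1 s Hs). lra. }
      nra.
Qed.

(** * The obstruction carried by a separatrix *)

(** The constant 1 is not in the range. Suppose that L u = 1. A curve
    whose ends go to the same infinity takes equal values x(t1) = x(t2) with t1 as close to a as
    one likes and t2 in the right half of the strip; translated so that this value is 0, it
    gives u(t2, 0) - u(t1, 0) = G(t2) - G(t1), where G is a primitive of 1/p. The left-hand side
    stays bounded, while G(t1) tends to minus infinity. The sign of e tells which infinity
    is reached. *)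
Lemma not_surjective_of_equal_limits (p q x : R -> R) (a b e : R) : a < b ->
  smooth1 p -> p a = 0 ->
  (forall t, a < t < b -> 0 < p t) ->
  (forall t, a < t < b -> is_derive x t (q t / p t)) ->
  filterlim (fun t => e * x t) (at_right a) (Rbar_locally p_infty) ->
  filterlim (fun t => e * x t) (at_left b) (Rbar_locally p_infty) ->
  e <> 0 ->
  ~ surjective_C_infty (vector_field p q).
Proof.
  intros Hab Sp Ha Hp Hx La Lb He Hsurj.
  pose proof (smooth1_continuity p Sp) as Cp.
  destruct (Hsurj (fun _ _ => 1)) as [u [Hu E]].
  { apply smooth_C_infty. intros n. apply Ck_const. }
  apply smooth_C_infty in Hu.
  set (m := (a + b) / 2). assert (Hm : a < m < b) by (unfold m; lra).
  destruct (characteristic_curve_exists p (fun _ => 1) a b m 0) as [G [HG _]];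
    auto.
  { intros t. apply continuity_pt_const. now intros y z. }
  { intros t Ht. specialize (Hp t Ht). lra. }
  assert (Su : smooth1 (fun t => u t 0)).
  { intros n. apply (Ck_comp n u (fun t _ => t) (fun _ _ => 0)); auto.
    - apply Ck_fst.
    - apply Ck_const. }
  destruct (continuous_bounded (fun t => u t 0) (Rmax (Rabs a) (Rabs b)))
    as [B [HB0 HB]].
  { now apply smooth1_continuity. }
  assert (HB' : forall t, a < t < b -> Rabs (u t 0) <= B).
  { intros t Ht. apply HB. apply (between_abs a b).
    - rewrite Rmin_left, Rmax_right; lra.
    - apply Rmax_l.
    - apply Rmax_r. }
  assert (LG : filterlim G (at_right a) (Rbar_locally m_infty)).
  { apply (limit_left_end p (fun _ => 1) G a b); auto; try lra.
    - destruct (smooth1_derive p Sp) as [p1 [_ D]]. now exists (p1 a).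
    - apply continuity_pt_const. now intros y z. }
  (* a point t1 near a where e x and - G are large *)
  assert (F1 : at_right a (fun t => e * x m < e * x t))
    by (apply (La (fun y => e * x m < y)); now exists (e * x m)).
  assert (F2 : at_right a (fun t => G t < G m - 2 * B))
    by (apply (LG (fun y => y < G m - 2 * B)); now exists (G m - 2 * B)).
  assert (F3 : at_right a (fun t => a < t < m)).
  { assert (Hd : 0 < m - a) by lra. exists (mkposreal _ Hd). intros t Ht Hat.
    change (Rabs (t - a) < m - a) in Ht. rewrite Rabs_right in Ht; lra. }
  destruct (filter_ex _ (filter_and _ _ (filter_and _ _ F1 F2) F3))
    as [t1 [[T1 T2] T3]].
  (* a point t3 beyond which e x is above its value at t1 *)
  assert (F4 : at_left b (fun t => e * x t1 < e * x t))
    by (apply (Lb (fun y => e * x t1 < y)); now exists (e * x t1)).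
  assert (F5 : at_left b (fun t => m < t < b)).
  { assert (Hd : 0 < b - m) by lra. exists (mkposreal _ Hd). intros t Ht Hat.
    change (Rabs (t - b) < b - m) in Ht. rewrite Rabs_left in Ht; lra. }
  destruct (filter_ex _ (filter_and _ _ F4 F5)) as [t3 [T4 T5]].
  destruct (intermediate_zero (fun t => e * x t - e * x t1) m t3)
    as [t2 [T6 T7]]; try lra.
  { intros t Ht. apply (is_derive_continuity_pt _ _ (e * (q t / p t) - 0)).
    apply (is_derive_minus (K := R_AbsRing) (V := R_NormedModule)
      (fun t => e * x t) (fun _ => e * x t1)).
    - apply (is_derive_scal x). apply Hx. lra.
    - apply (is_derive_const (K := R_AbsRing) (V := R_NormedModule)). }
  { nra. }
  assert (Ex : x t2 = x t1) by (apply Rmult_eq_reg_l with e; lra).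
  destruct (Hu 2%nat) as [_ [u1 [u2 [d1 [d2 [C1 C2]]]]]].
  set (phi := fun t => u t (x t - x t1)).
  assert (dphi : forall t, a < t < b -> is_derive phi t (1 / p t)).
  { intros t Ht. specialize (Hp t Ht). eapply is_derive_eq.
    - apply (is_derive_comp_2d u u1 u2 (fun t => t) (fun t => x t - x t1)); auto.
      + now apply (Ck_continuity 1).
      + apply (is_derive_id (K := R_AbsRing)).
      + apply (is_derive_minus (K := R_AbsRing) (V := R_NormedModule)
          x (fun _ => x t1)); [now apply Hx | apply is_derive_const].
    - specialize (E t (x t - x t1)). unfold vector_field in E.
      assert (D1 : Derive (fun s => u s (x t - x t1)) t = u1 t (x t - x t1))
        by (apply is_derive_unique, d1).
      assert (D2 : Derive (fun y => u t y) (x t - x t1) = u2 t (x t - x t1))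
        by (apply (is_derive_unique (u t)), d2).
      rewrite D1, D2 in E.
      unfold one, minus, plus, opp, zero; simpl.
      apply Rmult_eq_reg_r with (p t); [| lra].
      replace (1 / p t * p t) with 1 by (field; lra).
      transitivity (p t * u1 t (x t - x t1) + q t * u2 t (x t - x t1)); auto.
      field. lra. }
  assert (Hinc : G m <= G t2).
  { apply (nondecreasing_of_derive_on G (fun t => 1 / p t)); try lra.
    - intros t Ht. apply HG. lra.
    - intros t Ht. left. apply Rdiv_lt_0_compat; [lra |]. apply Hp. lra. }
  assert (Hle : G t2 - phi t2 <= G t1 - phi t1).
  { assert (Hz : forall t, t1 <= t <= t2 ->
      is_derive (fun t => phi t - G t) t (1 / p t - 1 / p t)).
    { intros t Ht. apply (is_derive_minus (K := R_AbsRing) (V := R_NormedModule)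
        phi G); [apply dphi | apply HG]; lra. }
    pose proof (nondecreasing_of_derive_on _ _ t1 t2 ltac:(lra) Hz) as H. cbv beta in H.
    assert (phi t1 - G t1 <= phi t2 - G t2) by (apply H; intros; lra). lra. }
  assert (E1 : phi t1 = u t1 0) by (unfold phi; f_equal; ring).
  assert (E2 : phi t2 = u t2 0) by (unfold phi; rewrite Ex; f_equal; ring).
  pose proof (HB' t1 ltac:(lra)) as B1. pose proof (HB' t2 ltac:(lra)) as B2.
  rewrite <- E1 in B1. rewrite <- E2 in B2.
  apply Rabs_le_between in B1. apply Rabs_le_between in B2. lra.
Qed.

Lemma filterlim_m_infty_opp (F : (R -> Prop) -> Prop) (x : R -> R) :
  filterlim x F (Rbar_locally m_infty) ->
  filterlim (fun t => -1 * x t) F (Rbar_locally p_infty).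
Proof.
  intros H P [M HM]. apply (H (fun y => P (-1 * y))).
  exists (- M). intros y Hy. apply HM. lra.
Qed.

Lemma separatrix_not_surjective (p q : R -> R) (a b : R) : a < b ->
  smooth1 p -> smooth1 q -> p a = 0 ->
  (forall t, a < t < b -> p t <> 0) -> separatrix p q a b ->
  ~ surjective_C_infty (vector_field p q).
Proof.
  intros Hab Sp Sq Ha Hp Hsep.
  pose proof (smooth1_continuity p Sp) as Cp.
  pose proof (smooth1_continuity q Sq) as Cq.
  assert (H : forall p q : R -> R, smooth1 p -> smooth1 q -> p a = 0 ->
    (forall t, a < t < b -> 0 < p t) -> separatrix p q a b ->
    ~ surjective_C_infty (vector_field p q)).
  { clear p q Sp Sq Ha Hp Hsep Cp Cq. intros p q Sp Sq Ha Hp Hsep.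
    destruct (characteristic_curve_exists p q a b ((a + b) / 2) 0) as [x Hx].
    - lra.
    - now apply smooth1_continuity.
    - now apply smooth1_continuity.
    - intros t Ht. specialize (Hp t Ht). lra.
    - specialize (Hsep ((a + b) / 2) 0 x ltac:(lra) Hx). destruct Hx as [Hx _].
      destruct Hsep as [[La Lb] | [La Lb]].
      + apply (not_surjective_of_equal_limits p q x a b 1); auto; try lra.
        * apply (filterlim_ext x); auto. intros; ring.
        * apply (filterlim_ext x); auto. intros; ring.
      + apply (not_surjective_of_equal_limits p q x a b (-1)); auto; try lra.
        * now apply filterlim_m_infty_opp.
        * now apply filterlim_m_infty_opp. }
  destruct (constant_sign p a b Hab Cp Hp) as [Hs | Hs].
  - now apply H.
  - intros Hsurj.
    apply (H (fun t => - p t) (fun t => - q t)).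
    + intros n. now apply (Ck_opp n (fun t _ => p t)).
    + intros n. now apply (Ck_opp n (fun t _ => q t)).
    + lra.
    + intros t Ht. specialize (Hs t Ht). lra.
    + apply separatrix_opp.
      * intros t Ht. specialize (Hs t Ht). lra.
      * replace (fun t => - - p t) with p by (extensionality t; ring).
        replace (fun t => - - q t) with q by (extensionality t; ring).
        exact Hsep.
    + apply surjective_opp.
      replace (fun t => - - p t) with p by (extensionality t; ring).
      replace (fun t => - - q t) with q by (extensionality t; ring).
      exact Hsurj.
Qed.

(** * The equivalences *)

Lemma no_node_between (t : nat -> R) (N : nat) :
  (forall i j, (1 <= i)%nat -> (i < j)%nat -> (j <= N)%nat -> t i < t j) ->
  forall i j, (1 <= j <= N - 1)%nat -> (1 <= i <= N)%nat ->
    ~ (t j < t i < t (S j)).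
Proof.
  intros Hinc i j Hj Hi [H1 H2].
  destruct (Nat.lt_trichotomy i j) as [L | [-> | L]].
  - pose proof (Hinc i j ltac:(lia) L ltac:(lia)). lra.
  - lra.
  - destruct (Nat.eq_dec i (S j)) as [-> | Hne]; [lra |].
    pose proof (Hinc (S j) i ltac:(lia) ltac:(lia) ltac:(lia)). lra.
Qed.

Lemma same_sign_as_first (c : nat -> R) (N : nat) : c 1%nat <> 0 ->
  (forall j, (1 <= j <= N - 1)%nat -> 0 < c j * c (S j)) ->
  forall j, (1 <= j <= N)%nat -> 0 < c 1%nat * c j.
Proof.
  intros H1 H j. induction j as [|j IH]; intros Hj; [lia |].
  destruct (Nat.eq_dec j 0) as [-> | Hne]; [nra |].
  specialize (IH ltac:(lia)). specialize (H j ltac:(lia)).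
  apply Rnot_le_lt. intros Hle.
  assert (0 < (c 1%nat * c j) * (c j * c (S j))) by (now apply Rmult_lt_0_compat).
  pose proof (pow2_ge_0 (c j)). nra.
Qed.

Lemma surjective_of_same_sign (p q : R -> R) (e : R) :
  is_polynomial p -> is_polynomial q -> (exists s, p s <> 0) ->
  (forall s, p s = 0 -> 0 < e * q s) ->
  surjective_C_infty (vector_field p q).
Proof.
  intros Hp Hq Hne H.
  destruct (Rtotal_order e 0) as [He | [He | He]].
  - apply surjective_opp, surjective_of_pos.
    + now apply polynomial_opp.
    + now apply polynomial_opp.
    + destruct Hne as [s Hs]. exists s. lra.
    + intros s Hs. specialize (H s ltac:(lra)). nra.
  - apply surjective_of_pos; auto.
    intros s Hs. specialize (H s Hs). rewrite He in H. lra.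
  - apply surjective_of_pos; auto.
    intros s Hs. specialize (H s Hs). nra.
Qed.

Lemma surjectivity_criterion (p q : R -> R) (N : nat) (t : nat -> R) :
    is_polynomial p ->
    is_polynomial q ->
    (forall s, ~ (p s = 0 /\ q s = 0)) ->
    (2 <= N)%nat ->
    (forall i j : nat, (1 <= i)%nat -> (i < j)%nat -> (j <= N)%nat ->
      t i < t j) ->
    (forall s, p s = 0 <-> exists j : nat, (1 <= j <= N)%nat /\ s = t j) ->
    (forall j : nat, (1 <= j <= N - 1)%nat ->
      forall s s', t j < s < t (S j) -> t j < s' < t (S j) ->
        q s = 0 -> q s' = 0 -> s = s') ->
    (~ surjective_C_infty (vector_field p q) <->
      exists j : nat, (1 <= j <= N - 1)%nat /\ separatrix p q (t j) (t (S j)))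
    /\
    ((exists j : nat, (1 <= j <= N - 1)%nat /\
        separatrix p q (t j) (t (S j))) <->
      exists (j : nat) (theta : R), (1 <= j <= N - 1)%nat /\
        t j < theta < t (S j) /\ q theta = 0 /\
        opposite_signs q (t j) theta (t (S j))).
Proof.
  intros Hp Hq Hpq HN Hinc Hz Hu.
  pose proof (polynomial_smooth p Hp) as Sp.
  pose proof (polynomial_smooth q Hq) as Sq.
  assert (P0 : forall j, (1 <= j <= N)%nat -> p (t j) = 0)
    by (intros j Hj; apply Hz; now exists j).
  assert (Q0 : forall j, (1 <= j <= N)%nat -> q (t j) <> 0)
    by (intros j Hj E; apply (Hpq (t j)); auto).
  assert (Pne : forall j s, (1 <= j <= N - 1)%nat -> t j < s < t (S j) ->
    p s <> 0).
  { intros j s Hj Hs E. apply Hz in E. destruct E as [i [Hi ->]].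
    now apply (no_node_between t N Hinc i j). }
  assert (Hlt : forall j, (1 <= j <= N - 1)%nat -> t j < t (S j))
    by (intros j Hj; apply Hinc; lia).
  assert (Hsep : forall j, (1 <= j <= N - 1)%nat ->
    (separatrix p q (t j) (t (S j)) <-> q (t j) * q (t (S j)) < 0)).
  { intros j Hj. apply separatrix_iff; auto.
    - apply P0; lia.
    - apply P0; lia.
    - intros s. now apply Pne.
    - apply Q0; lia.
    - apply Q0; lia. }
  assert (Hopp : forall j, (1 <= j <= N - 1)%nat ->
    (q (t j) * q (t (S j)) < 0 <-> exists theta, t j < theta < t (S j) /\
      q theta = 0 /\ opposite_signs q (t j) theta (t (S j)))).
  { intros j Hj. apply opposite_signs_iff; auto.
    - now apply smooth1_continuity.
    - apply Q0; lia.
    - apply Q0; lia.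
    - intros s s'. now apply Hu. }
  split; [split |].
  - intros Hns. apply NNPP. intros Hno. apply Hns.
    apply (surjective_of_same_sign p q (q (t 1%nat))); auto.
    + exists ((t 1%nat + t 2%nat) / 2). apply (Pne 1%nat); [lia |].
      pose proof (Hlt 1%nat ltac:(lia)). lra.
    + intros s Hs. apply Hz in Hs. destruct Hs as [j [Hj ->]].
      apply (same_sign_as_first (fun j => q (t j)) N); auto.
      * apply Q0. lia.
      * clear j Hj. intros j Hj. apply Rnot_le_lt. intros [Hle | Hle].
        -- apply Hno. exists j. split; auto. now apply Hsep.
        -- apply Rmult_integral in Hle.
           destruct Hle as [Hle | Hle]; revert Hle; apply Q0; lia.
  - intros [j [Hj HS]].
    apply (separatrix_not_surjective p q (t j) (t (S j))); auto.
    + apply P0. lia.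
    + intros s. now apply Pne.
  - split.
    + intros [j [Hj HS]]. apply Hsep, Hopp in HS; auto.
      destruct HS as [theta HS]. exists j, theta. tauto.
    + intros [j [theta [Hj HS]]]. exists j. split; auto.
      apply Hsep, Hopp; auto. now exists theta.
Qed.

(** * The model operators *)

Lemma monomial_polynomial (c : R) (k : nat) : is_polynomial (fun t => c * t ^ k).
Proof.
  exists (fun i => if Nat.eq_dec i k then c else 0), k. intros t.
  assert (Hz : forall d, (d < k)%nat ->
    sum_f_R0 (fun i => (if Nat.eq_dec i k then c else 0) * t ^ i) d = 0).
  { induction d as [|d IH]; intros Hd.
    - destruct k; [lia |]. simpl. ring.
    - rewrite tech5, IH by lia. destruct (Nat.eq_dec (S d) k); [lia | ring]. }
  destruct k as [|k].
  - simpl. ring.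
  - rewrite tech5, Hz by lia. destruct (Nat.eq_dec (S k) (S k)); [ring | lia].
Qed.

Lemma odd_pow_opp (s : R) (k : nat) : Nat.Odd k -> (- s) ^ k = - s ^ k.
Proof.
  intros [m ->]. rewrite Nat.add_1_r, <- !tech_pow_Rmult, !pow_mult.
  replace ((- s) ^ 2) with (s ^ 2) by ring. ring.
Qed.

Lemma even_pow_opp (s : R) (k : nat) : Nat.Even k -> (- s) ^ k = s ^ k.
Proof.
  intros [m ->]. rewrite !pow_mult. f_equal. ring.
Qed.

Lemma pow_eq_0 (s : R) (k : nat) : s ^ k = 0 -> s = 0.
Proof.
  intros H. apply NNPP. intros Hs. now apply (pow_nonzero s k).
Qed.

(** The only possible sign change is at 0. *)
Lemma odd_monomial_iff (lambda : R) (k : nat) : lambda <> 0 ->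
  (Nat.Odd k <-> exists theta, -1 < theta < 1 /\ lambda * theta ^ k = 0 /\
    opposite_signs (fun t => lambda * t ^ k) (-1) theta 1).
Proof.
  intros Hl. split.
  - intros Hk. exists 0.
    assert (H0 : 0 ^ k = 0) by (destruct Hk as [m ->]; apply pow_i; lia).
    split; [lra | split; [rewrite H0; ring |]].
    assert (Hneg : forall s, s < 0 -> s ^ k < 0).
    { intros s Hs. rewrite <- (Ropp_involutive s), (odd_pow_opp _ k Hk).
      pose proof (pow_lt (- s) k ltac:(lra)). lra. }
    destruct (Rdichotomy lambda 0 Hl) as [L | L]; [left | right];
      split; intros s Hs.
    + specialize (Hneg s ltac:(lra)). nra.
    + pose proof (pow_lt s k ltac:(lra)). nra.
    + specialize (Hneg s ltac:(lra)). nra.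
    + pose proof (pow_lt s k ltac:(lra)). nra.
  - intros [theta [_ [Hth Hs]]].
    apply Rmult_integral in Hth. destruct Hth as [Hth | Hth]; [easy |].
    apply pow_eq_0 in Hth. subst theta.
    destruct (Nat.Even_or_Odd k) as [Hk | Hk]; auto. exfalso.
    pose proof (even_pow_opp (/ 2) k Hk) as E.
    destruct Hs as [[H1 H2] | [H1 H2]];
      specialize (H1 (- / 2) ltac:(lra)); specialize (H2 (/ 2) ltac:(lra));
      rewrite E in H1; lra.
Qed.

Theorem theorem1p2 :
  (forall (p q : R -> R) (N : nat) (t : nat -> R),
    is_polynomial p ->
    is_polynomial q ->
    (forall s, ~ (p s = 0 /\ q s = 0)) ->
    (2 <= N)%nat ->
    (forall i j : nat, (1 <= i)%nat -> (i < j)%nat -> (j <= N)%nat ->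
      t i < t j) ->
    (forall s, p s = 0 <-> exists j : nat, (1 <= j <= N)%nat /\ s = t j) ->
    (forall j : nat, (1 <= j <= N)%nat -> Derive p (t j) <> 0) ->
    (forall j : nat, (1 <= j <= N - 1)%nat ->
      forall s s', t j < s < t (S j) -> t j < s' < t (S j) ->
        q s = 0 -> q s' = 0 -> s = s') ->
    (~ surjective_C_infty (vector_field p q) <->
      exists j : nat, (1 <= j <= N - 1)%nat /\ separatrix p q (t j) (t (S j)))
    /\
    ((exists j : nat, (1 <= j <= N - 1)%nat /\
        separatrix p q (t j) (t (S j))) <->
      exists (j : nat) (theta : R), (1 <= j <= N - 1)%nat /\
        t j < theta < t (S j) /\ q theta = 0 /\
        opposite_signs q (t j) theta (t (S j))))
  /\
  (forall (lambda : R) (k : nat), lambda <> 0 ->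
    (~ surjective_C_infty
         (vector_field (fun t => 1 - t ^ 2) (fun t => lambda * t ^ k)) <->
     Nat.Odd k)).
Proof.
  split.
  - intros p q N t Hp Hq Hpq HN Hinc Hz _ Hu.
    now apply surjectivity_criterion.
  - intros lambda k Hl.
    set (t := fun j : nat => 2 * INR j - 3).
    assert (T1 : t 1%nat = -1) by (unfold t; simpl; ring).
    assert (T2 : t 2%nat = 1) by (unfold t; simpl; ring).
    destruct (surjectivity_criterion (fun t => 1 - t ^ 2)
      (fun t => lambda * t ^ k) 2 t) as [H1 H2].
    + exists (fun i => match i with O => 1 | 1%nat => 0 | _ => -1 end), 2%nat.
      intros s. simpl. ring.
    + apply monomial_polynomial.
    + intros s [A B]. apply Rmult_integral in B. destruct B as [B | B]; auto.
      apply pow_eq_0 in B. rewrite B in A. lra.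
    + lia.
    + intros i j _ Hij _. apply lt_INR in Hij. unfold t. lra.
    + intros s. split.
      * intros E. assert (E' : (s + 1) * (s - 1) = 0) by lra.
        apply Rmult_integral in E'. destruct E' as [E' | E'].
        -- exists 1%nat. split; [lia |]. lra.
        -- exists 2%nat. split; [lia |]. lra.
      * intros [j [Hj ->]].
        assert (C : j = 1%nat \/ j = 2%nat) by lia.
        destruct C as [-> | ->]; [rewrite T1 | rewrite T2]; ring.
    + intros j _ s s' _ _ A B.
      apply Rmult_integral in A. apply Rmult_integral in B.
      destruct A as [A | A]; [easy |]. destruct B as [B | B]; [easy |].
      apply pow_eq_0 in A. apply pow_eq_0 in B. lra.
    + rewrite H1, H2, (odd_monomial_iff lambda k Hl). split.
      * intros [j [theta [Hj HS]]]. assert (j = 1%nat) by lia. subst j.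
        rewrite T1, T2 in HS. now exists theta.
      * intros [theta HS]. exists 1%nat, theta. rewrite T1, T2.
        split; [lia | exact HS].
Qed.
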